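(* Let $\pi:A\to M$ be a differentiable vector bundle over $M$ and let $(\Lambda,E)$ be a Jacobi structure on the (total space of the) dual bundle $\pi^\ast:A^\ast\to M$ satisfying: (C1) the Jacobi bracket of any two linear functions on $A^\ast$ is again a linear function; (C2) the Jacobi bracket of any linear function on $A^\ast$ and the constant function $1$ is a basic function. Then there is a Lie algebroid structure $([\![\cdot,\cdot]\!],\rho)$ on $\pi:A\to M$ and a 1-cocycle $\phi\in\Gamma(A^\ast)$ of this Lie algebroid such that $\Lambda=\Lambda_{(A^\ast,\phi)}$ and $E=E_{(A^\ast,\phi)}$, where $\Lambda_{(A^\ast,\phi)}=\Lambda_{A^\ast}+\Delta\wedge\phi^v$ and $E_{(A^\ast,\phi)}=-\phi^v$.
   Context: All manifolds, bundles, sections and functions are $C^\infty$. $\Gamma(A)$ is the space of global sections of $A$, and $\mathfrak{X}(M)$ is the Lie algebra of vector fields on $M$. Jacobi structure: a pair $(\Lambda,E)$ on a manifold $N$, with $\Lambda$ a 2-vector (bivector field) and $E$ a vector field, such that $[\Lambda,\Lambda]_{SN}=2E\wedge\Lambda$ and $[E,\Lambda]_{SN}=0$, where $[\cdot,\cdot]_{SN}$ is the Schouten-Nijenhuis bracket. Its Jacobi bracket is $\{F,G\}=\Lambda(dF,dG)+F\,E(G)-G\,E(F)$ for $F,G\in C^\infty(N,\mathbb{R})$. The sign convention for the Schouten-Nijenhuis bracket is the one for which $(\Lambda,E)$ is a Jacobi structure if and only if $\{\cdot,\cdot\}$ satisfies the Jacobi identity. Wedge convention: $(X\wedge Y)(\alpha,\beta)=\alpha(X)\beta(Y)-\alpha(Y)\beta(X)$.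 A Poisson structure is a Jacobi structure with $E=0$. Lie algebroid structure on $\pi:A\to M$: a pair $([\![\cdot,\cdot]\!],\rho)$ consisting of a (real) Lie algebra bracket $[\![\cdot,\cdot]\!]$ on $\Gamma(A)$ and a vector bundle homomorphism $\rho:A\to TM$ (the anchor map; the induced $C^\infty(M,\mathbb{R})$-module map $\Gamma(A)\to\mathfrak{X}(M)$ is also denoted $\rho$) such that $\rho:\Gamma(A)\to\mathfrak{X}(M)$ is a Lie algebra homomorphism and $[\![\mu,\bar f\eta]\!]=\bar f[\![\mu,\eta]\!]+(\rho(\mu)(\bar f))\eta$ for all $\mu,\eta\in\Gamma(A)$, $\bar f\in C^\infty(M,\mathbb{R})$. 1-cocycle: a section $\phi\in\Gamma(A^\ast)$ with $\phi([\![\mu,\eta]\!])=\rho(\mu)(\phi(\eta))-\rho(\eta)(\phi(\mu))$ for all $\mu,\eta\in\Gamma(A)$. For $\mu\in\Gamma(A)$, $\tilde\mu\in C^\infty(A^\ast,\mathbb{R})$ is the fibrewise linear function $\tilde\mu(\alpha)=\alpha(\mu(\pi^\ast(\alpha)))$. A linear function on $A^\ast$ is a function of the form $\tilde\mu$ with $\mu\in\Gamma(A)$; a basic function on $A^\ast$ is a function of the form $\bar f\circ\pi^\ast$ with $\bar f\in C^\infty(M,\mathbb{R})$. Local coordinates: let $(x^1,\dots,x^m)$ be coordinates on an open set $U\subseteq M$, $\{e_i\}_{i=1,\dots,n}$ a local basis of sections of $A$ over $U$ with dual basis $\{e^i\}$, and $(x^i,\mu_j)$ the induced coordinates on $(\pi^\ast)^{-1}(U)$,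 with $\mu_j=\tilde e_j$. Given a Lie algebroid structure, write $[\![e_i,e_j]\!]=\sum_k c_{ij}^k e_k$ and $\rho(e_i)=\sum_l\rho_i^l\,\partial/\partial x^l$. $\Lambda_{A^\ast}$ is the Poisson structure on $A^\ast$ induced by the Lie algebroid structure, given locally by $$\Lambda_{A^\ast}=\sum_{i<j}\sum_k c_{ij}^k\mu_k\frac{\partial}{\partial\mu_i}\wedge\frac{\partial}{\partial\mu_j}+\sum_{i,l}\rho_i^l\frac{\partial}{\partial\mu_i}\wedge\frac{\partial}{\partial x^l}.$$ $\Delta$ is the Liouville vector field of $A^\ast$, locally $\Delta=\sum_i\mu_i\,\partial/\partial\mu_i$. $\phi^v\in\mathfrak{X}(A^\ast)$ is the vertical lift of $\phi\in\Gamma(A^\ast)$: if $\phi=\sum_i\phi_i e^i$ locally, then $\phi^v=\sum_i\phi_i\,\partial/\partial\mu_i$ (with $\phi_i$ regarded as a function on $(\pi^\ast)^{-1}(U)$ by composition with $\pi^\ast$, and similarly for $c_{ij}^k,\rho_i^l$).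
   Formalization: The vector bundle is assumed to have rank at least 1; for rank 0 the claim fails, since then (C1) and (C2) hold for every Jacobi structure on M (for example the symplectic plane) while the conclusion forces Λ = 0 and E = 0. *)

(* Defs.v *)
From HB Require Import structures.
From mathcomp Require Import all_boot all_order all_algebra.
From mathcomp Require Import all_classical all_reals all_analysis.

Set Implicit Arguments.
Unset Strict Implicit.
Unset Printing Implicit Defensive.

Import Order.TTheory GRing.Theory Num.Theory.
Import numFieldNormedType.Exports.
Local Open Scope classical_set_scope.
Local Open Scope ring_scope.

Section CInfinity.
Context {R : realType} {d : nat}.
Implicit Types (U : set 'rV[R]_d) (f g : 'rV[R]_d -> R).

Definition partial (i : 'I_d) f : 'rV[R]_d -> R := 'D_(delta_mx 0 i) f.

(* All partial derivatives of order at most [k] exist on [U] and those of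
   order [k] are continuous on [U]. *)
Fixpoint Ck_on (k : nat) U f : Prop :=
  if k is k'.+1 then
    forall i, (forall x, U x -> derivable f x (delta_mx 0 i)) /\
              Ck_on k' U (partial i f)
  else forall x, U x -> {for x, continuous f}.

(* Meaningful for open [U] only. *)
Definition smooth_on U f : Prop := forall k, Ck_on k U f.

Lemma smooth_onS U f : smooth_on U f <->
  (forall x, U x -> {for x, continuous f}) /\
  forall i, (forall x, U x -> derivable f x (delta_mx 0 i)) /\
            smooth_on U (partial i f).
Proof.
split=> [fs|[f0 fs] [|k] //= i]; last first.
  by split; [case: (fs i)|case: (fs i) => _; apply].
split; first exact: (fs 0%N).
move=> i; split=> [|k]; first by case: (fs 1%N i).
by case: (fs k.+1 i).
Qed.

Lemma eq_Ck_on k U f g : open U -> (forall x, U x -> f x = g x) ->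
  Ck_on k U f -> Ck_on k U g.
Proof.
move=> oU; elim: k f g => [|k IH] f g fg fk /=.
  move=> x Ux; rewrite /prop_for /continuous_at -(fg x Ux).
  apply: cvg_trans (fk x Ux); apply: (@near_eq_cvg _ _ (nbhs x)).
  apply: (@filterS _ (nbhs x) _ U) (open_nbhs_nbhs (conj oU Ux)) => y Uy; exact: fg.
have near_fg x : U x -> \near x, f x = g x.
  move=> Ux; apply: (@filterS _ (nbhs x) _ U) (open_nbhs_nbhs (conj oU Ux)) => y Uy; exact: fg.
move=> i; have [df Df] := fk i; split.
  by move=> x Ux; apply: near_eq_derivable (near_fg _ Ux) (df _ Ux).
apply: (IH (partial i f)) => // x Ux.
exact: near_eq_derive (near_fg _ Ux).
Qed.

Lemma smooth_on_sub U V f : U `<=` V -> smooth_on V f -> smooth_on U f.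
Proof.
move=> UV + k; elim: k f => [|k IH] f fs; first by move=> x /UV /(fs 0%N).
move/smooth_onS: fs => [_ fs] i; have [df Df] := fs i; split; last exact: IH.
by move=> x /UV /df.
Qed.

Lemma smooth_on_cst U (a : R) : smooth_on U (fun=> a).
Proof.
move=> k; elim: k a => [|k IH] a; first by move=> x _; exact: cst_continuous.
move=> i; split; first by move=> x _; exact: derivable_cst.
have -> : partial i (fun=> a) = fun=> 0; last exact: IH.
by apply/funext => x; exact: derive_cst.
Qed.

Lemma Ck_onD k U f g : open U -> Ck_on k U f -> Ck_on k U g ->
  Ck_on k U (fun x => f x + g x).
Proof.
move=> oU; elim: k f g => [|k IH] f g fk gk.
  by move=> x Ux; apply: continuousD; [exact: fk|exact: gk].
move=> i; have [df Df] := fk i; have [dg Dg] := gk i; split.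
  by move=> x Ux; apply: derivableD; [exact: df|exact: dg].
apply: (@eq_Ck_on _ _ (fun x => partial i f x + partial i g x)) => //.
  move=> x Ux; rewrite /partial; symmetry.
  by apply: deriveD; [exact: df|exact: dg].
exact: IH.
Qed.

Lemma smooth_onM U f g : open U -> smooth_on U f -> smooth_on U g ->
  smooth_on U (fun x => f x * g x).
Proof.
move=> oU + + k; elim: k f g => [|k IH] f g fs gs.
  by move=> x Ux; apply: continuousM; [exact: (fs 0%N)|exact: (gs 0%N)].
have /smooth_onS[_ fS] := fs; have /smooth_onS[_ gS] := gs => i.
have [df Df] := fS i; have [dg Dg] := gS i; split.
  by move=> x Ux; apply: derivableM; [exact: df|exact: dg].
apply: (@eq_Ck_on _ _
  (fun x => f x * partial i g x + g x * partial i f x)) => //.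
  move=> x Ux; rewrite /partial; symmetry.
  by apply: deriveM; [exact: df|exact: dg].
by apply: Ck_onD => //; apply: IH.
Qed.

Lemma smooth_on_sum U n (h : 'I_n -> 'rV[R]_d -> R) : open U ->
  (forall i, smooth_on U (h i)) -> smooth_on U (fun x => \sum_(i < n) h i x).
Proof.
move=> oU; elim: n h => [|n IH] h hs k.
  rewrite [X in Ck_on _ _ X](_ : _ = fun=> 0); first exact: smooth_on_cst.
  by apply/funext => x; rewrite big_ord0.
rewrite [X in Ck_on _ _ X](_ : _ =
    fun x => \sum_(i < n) h (widen_ord (leqnSn n) i) x + h ord_max x).
  by apply: Ck_onD => //; [apply: IH|apply: hs].
by apply/funext => x; rewrite big_ord_recr.
Qed.

Lemma smooth_on_coord U (i : 'I_d) : smooth_on U (fun x => x 0 i).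
Proof.
case=> [|k]; first by move=> x _; exact: coord_continuous.
have D (v x : 'rV[R]_d) : is_derive x v (fun x => x 0 i) (v 0 i).
  have cf : continuous (fun x : 'rV[R]_d => x 0 i) by exact: coord_continuous.
  have h (u : 'rV[R]_d) :
      (fun t : R => t^-1 *: (((fun x : 'rV[R]_d => x 0 i) \o shift u) (t *: v)
                            - u 0 i)) @ 0^' --> v 0 i.
    apply: (@cvg_trans _ ((fun=> v 0 i) @ (0 : R)^')); last exact: cvg_cst.
    apply: near_eq_cvg; near=> t.
    rewrite /= !mxE addrK scalerA mulVf ?scale1r//.
    by near: t; exact: nbhs_dnbhs_neq.
  by apply: DeriveDef; [apply/cvg_ex; exists (v 0 i); exact: h
                       |exact/cvg_lim/h].
move=> j; split; first by move=> x _; case: (D (delta_mx 0 j) x).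
rewrite [X in Ck_on _ _ X](_ : _ = fun=> (delta_mx 0 j : 'rV[R]_d) 0 i).
  exact: smooth_on_cst.
by apply/funext => x; exact: derive_val.
Unshelve. all: by end_near. Qed.

End CInfinity.

Lemma smooth_on_lsubmx (R : realType) (m n : nat) (U : set 'rV[R]_m)
    (f : 'rV[R]_m -> R) : smooth_on U f ->
  smooth_on [set y : 'rV[R]_(m + n) | U (lsubmx y)] (fun y => f (lsubmx y)).
Proof.
move=> + k; elim: k f => [|k IH] f fs.
  move=> y Uy; apply: (@continuous_comp _ _ _ lsubmx f).
    exact: continuous_lsubmx.
  exact: (fs 0%N).
have eqD (v y : 'rV[R]_(m + n)) :
    (fun h : R => h^-1 *: (((fun y => f (lsubmx y)) \o shift y) (h *: v)
                            - f (lsubmx y))) =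
    (fun h : R => h^-1 *: ((f \o shift (lsubmx y)) (h *: lsubmx v)
                            - f (lsubmx y))).
  apply/funext => h /=; rewrite (_ : lsubmx _ = h *: lsubmx v + lsubmx y)//.
  by apply/rowP => j; rewrite !mxE.
move/smooth_onS: fs => [_ fs] i.
rewrite /partial /derivable /derive.
case: (split_ordP i) => l ->.
  have el : lsubmx (delta_mx 0 (lshift n l) : 'rV[R]_(m + n)) = delta_mx 0 l.
    by apply/rowP => j; rewrite !mxE (inj_eq (@lshift_inj _ _)).
  have [df Df] := fs l; split=> [y Uy|].
    by rewrite eqD el; exact: df.
  have -> : (fun y : 'rV[R]_(m + n) =>
      'D_(delta_mx 0 (lshift n l)) (fun y => f (lsubmx y)) y) =
      fun y => partial l f (lsubmx y).
    by apply/funext => y; rewrite /partial /derive eqD el.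
  exact: IH.
have el : lsubmx (delta_mx 0 (rshift m l) : 'rV[R]_(m + n)) = 0.
  by apply/rowP => j; rewrite !mxE eq_lrshift andbF.
split=> [y Uy|]; first by rewrite eqD el; exact: derivable0.
have -> : (fun y : 'rV[R]_(m + n) =>
    'D_(delta_mx 0 (rshift m l)) (fun y => f (lsubmx y)) y) = fun=> 0.
  by apply/funext => y; rewrite /derive eqD el; exact: derive0.
exact: smooth_on_cst.
Qed.

(* A smooth atlas modelled on R^d: the chart [c] is the bijection [co c] from
   [cdom c] onto [co c @` cdom c], with inverse [pt c]; the values of [co c]
   and [pt c] outside these sets are irrelevant. *)
Record atlas (R : realType) (d : nat) (N : Type) := Atlas {
  chart : Type;
  cdom : chart -> set N;
  co : chart -> N -> 'rV[R]_d;
  pt : chart -> 'rV[R]_d -> N;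
  chart_at : N -> chart;
  chart_atP : forall p, cdom (chart_at p) p;
  coK : forall c p, cdom c p -> pt c (co c p) = p;
  co_open : forall c c', open (co c @` (cdom c `&` cdom c'));
  co_smooth : forall c c' l, smooth_on (co c @` (cdom c `&` cdom c'))
                                       (fun y => co c' (pt c y) 0 l)
}.

Record manifold (R : realType) (m : nat) := Manifold {
  carrier :> topologicalType;
  mfd_atlas :> atlas R m carrier;
  mfd_hausdorff : hausdorff_space carrier;
  mfd_second_countable : @second_countable carrier;
  cdom_open : forall c : chart mfd_atlas, open (cdom c);
  co_continuous : forall (c : chart mfd_atlas) x, cdom c x ->
    {for x, continuous (co c)};
  pt_continuous : forall (c : chart mfd_atlas) y, (co c @` cdom c) y ->
    {for y, continuous (pt c)}
}.

Section Tensors.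
Context {R : realType} {d : nat} {N : Type} (At : atlas R d N).
Implicit Types (c : chart At) (p : N) (F G : N -> R).

(* Meaningful for open [W] only. *)
Definition smooth_fun_on (W : set N) F : Prop :=
  forall c, smooth_on (co c @` (cdom c `&` W)) (F \o pt c).

Definition smooth_fun F : Prop := smooth_fun_on setT F.

(* dF/dx^i at p, in the coordinates x of the chart c. *)
Definition dpartial c (i : 'I_d) F p : R := partial i (F \o pt c) (co c p).

(* [jacobian c c' p i l] is dx'^l/dx^i at p. *)
Definition jacobian c c' p : 'M[R]_d :=
  \matrix_(i, l) dpartial c i (fun q => co c' q 0 l) p.

(* A tangent vector is given by its components in every chart around p (the
   components in the other charts are irrelevant); likewise for 2-vectors:
   [v c i j] is v(dx^i, dx^j). *)
Record tangent p := Tangent {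
  tcomp :> chart At -> 'rV[R]_d;
  tcomp_change : forall c c', cdom c p -> cdom c' p ->
    tcomp c' = tcomp c *m jacobian c c' p
}.

Record bivector p := Bivector {
  bcomp :> chart At -> 'M[R]_d;
  bcomp_skew : forall c, cdom c p -> (bcomp c)^T = - bcomp c;
  bcomp_change : forall c c', cdom c p -> cdom c' p ->
    bcomp c' = (jacobian c c' p)^T *m bcomp c *m jacobian c c' p
}.

Record vector_field := VectorField {
  vf :> forall p, tangent p;
  vf_smooth : forall c i, smooth_fun_on (cdom c) (fun p => vf p c 0 i)
}.

Record bivector_field := BivectorField {
  bf :> forall p, bivector p;
  bf_smooth : forall c i j, smooth_fun_on (cdom c) (fun p => bf p c i j)
}.

(* Components, in every chart, of a would-be vector or 2-vector field. *)
Definition field1 := N -> chart At -> 'rV[R]_d.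
Definition field2 := N -> chart At -> 'M[R]_d.
Implicit Types (X Y : field1) (P Q : field2).

Definition comp1 (X : vector_field) : field1 := fun p c => X p c.
Definition comp2 (P : bivector_field) : field2 := fun p c => P p c.

Definition eq_field1 X Y : Prop := forall p c, cdom c p -> X p c = Y p c.
Definition eq_field2 P Q : Prop := forall p c, cdom c p -> P p c = Q p c.

Definition vf_apply X F p : R :=
  \sum_i X p (chart_at At p) 0 i * dpartial (chart_at At p) i F p.

Definition bf_apply P F G p : R :=
  \sum_i \sum_j P p (chart_at At p) i j *
    dpartial (chart_at At p) i F p * dpartial (chart_at At p) j G p.

Definition lie_bracket X Y : field1 := fun p c =>
  \row_j \sum_i (X p c 0 i * dpartial c i (fun q => Y q c 0 j) p
               - Y p c 0 i * dpartial c i (fun q => X q c 0 j) p).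

(* (u /\ v)(a, b) = a(u) b(v) - a(v) b(u) *)
Definition wedge (u v : 'rV[R]_d) : 'M[R]_d := u^T *m v - v^T *m u.

(* Components of the Schouten-Nijenhuis brackets [X, P] (the Lie derivative of
   P along X) and [P, Q], and of X /\ P. The normalization of the second one
   gives [P, P](dF, dG, dH) = 2 (P(d(P(dF, dG)), dH) + cyclic permutations),
   which is the sign for which [P, P] = 2 E /\ P and [E, P] = 0 amount to the
   Jacobi identity of the Jacobi bracket below. *)
Definition schouten12 X P : field2 := fun p c =>
  \matrix_(i, j) \sum_l (X p c 0 l * dpartial c l (fun q => P q c i j) p
    - P p c l j * dpartial c l (fun q => X q c 0 i) p
    - P p c i l * dpartial c l (fun q => X q c 0 j) p).

Definition schouten22 P Q p c (i j k : 'I_d) : R :=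
  let term i j k := \sum_l (P p c l i * dpartial c l (fun q => Q q c j k) p
                          + Q p c l i * dpartial c l (fun q => P q c j k) p) in
  term i j k + term j k i + term k i j.

Definition wedge12 X P p c (i j k : 'I_d) : R :=
  X p c 0 i * P p c j k + X p c 0 j * P p c k i + X p c 0 k * P p c i j.

Definition jacobi_structure (L : bivector_field) (E : vector_field) : Prop :=
  (forall p c, cdom c p -> forall i j k,
     schouten22 (comp2 L) (comp2 L) p c i j k
     = 2 * wedge12 (comp1 E) (comp2 L) p c i j k) /\
  eq_field2 (schouten12 (comp1 E) (comp2 L)) (fun _ _ => 0).

Definition jacobi_bracket (L : bivector_field) (E : vector_field) F G : N -> R :=
  fun p => bf_apply (comp2 L) F G p
    + F p * vf_apply (comp1 E) G p - G p * vf_apply (comp1 E) F p.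

End Tensors.

(* A vector bundle of rank n over M: a family of vector spaces together with
   local frames [frame j] over the open sets [vdom j] (with associated
   coordinates [coord j]) related by smooth matrices. *)
Record vector_bundle (R : realType) (m : nat) (M : manifold R m) (n : nat) :=
  VectorBundle {
  fiber : M -> lmodType R;
  triv : Type;
  vdom : triv -> set M;
  vdom_open : forall j, open (vdom j);
  triv_at : M -> triv;
  triv_atP : forall x, vdom (triv_at x) x;
  frame : triv -> forall x, 'I_n -> fiber x;
  coord : triv -> forall x, {linear fiber x -> 'rV[R]_n};
  coord_frame : forall j x i, vdom j x -> coord j x (frame j x i) = delta_mx 0 i;
  coordK : forall j x v, vdom j x -> \sum_i coord j x v 0 i *: frame j x i = v;
  coord_smooth : forall j k i l, smooth_fun_on M (vdom j `&` vdom k)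
                                   (fun x => coord k x (frame j x i) 0 l)
}.

Lemma scalar_eq (R : realType) (V : lmodType R) (f g : {scalar V}) :
  f =1 g -> f = g.
Proof.
case: f g => f [[f1] [f2]] [g [[g1] [g2]]] /= /funext fg; subst g.
by rewrite (Prop_irrelevance f1 g1) (Prop_irrelevance f2 g2).
Qed.

Section Bundle.
Context {R : realType} {m n : nat} {M : manifold R m} (A : vector_bundle M n).

Definition smooth_section (mu : forall x, fiber A x) : Prop :=
  forall j l, smooth_fun_on M (vdom j) (fun x => coord j x (mu x) 0 l).

Definition smooth_dual_section (phi : forall x, {scalar fiber A x}) : Prop :=
  forall j i, smooth_fun_on M (vdom j) (fun x => phi x (frame j x i)).

(* The total space of A^*. Its smooth structure is given by the charts
   (x^l, mu_i) below, indexed by a chart of M and a local frame of A; its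
   topology is the one for which these are homeomorphisms, and is not needed. *)

Definition dual_total : Type := {x : M & {scalar fiber A x}}.
Definition dual_proj (p : dual_total) : M := projT1 p.
Definition dual_form (p : dual_total) : {scalar fiber A (dual_proj p)} :=
  projT2 p.

(* The form \sum_i a_i e^i, where e^i is the coframe dual to [frame j]. *)
Definition coform (j : triv A) (x : M) (a : 'rV[R]_n) (v : fiber A x) : R :=
  \sum_i a 0 i * coord j x v 0 i.

Lemma coform_linear j x a : linear_for *%R (@coform j x a).
Proof.
move=> k u v; rewrite /coform linearP mulr_sumr -big_split/=.
by apply: eq_bigr => i _; rewrite !mxE mulrDr mulrCA.
Qed.

Lemma coform_frame j x a i : vdom j x -> @coform j x a (frame j x i) = a 0 i.
Proof.
move=> jx; rewrite /coform (bigD1 i)//= coord_frame// mxE !eqxx mulr1.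
rewrite big1 ?addr0// => l li.
by rewrite mxE (negbTE li) andbF mulr0.
Qed.

HB.instance Definition _ j x a :=
  GRing.isLinear.Build R (fiber A x) R *%R (@coform j x a) (coform_linear j a).

Definition dual_chart : Type := (chart M * triv A)%type.

Definition dual_cdom (c : dual_chart) : set dual_total :=
  [set p | cdom c.1 (dual_proj p) /\ vdom c.2 (dual_proj p)].

Definition dual_co (c : dual_chart) (p : dual_total) : 'rV[R]_(m + n) :=
  row_mx (co c.1 (dual_proj p)) (\row_i dual_form p (frame c.2 (dual_proj p) i)).

Definition dual_pt (c : dual_chart) (y : 'rV[R]_(m + n)) : dual_total :=
  existT _ (pt c.1 (lsubmx y))
    (@coform c.2 (pt c.1 (lsubmx y)) (rsubmx y) : {scalar fiber A _}).

Definition dual_chart_at (p : dual_total) : dual_chart :=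
  (chart_at M (dual_proj p), triv_at A (dual_proj p)).

Lemma dual_chart_atP p : dual_cdom (dual_chart_at p) p.
Proof. by split; [exact: chart_atP|exact: triv_atP]. Qed.

Lemma dual_coK c p : dual_cdom c p -> dual_pt c (dual_co c p) = p.
Proof.
case: p => x a [/= cx jx]; rewrite /dual_pt /dual_co /dual_proj /dual_form /=.
rewrite row_mxKl row_mxKr coK//; congr existT.
apply: scalar_eq => v /=; rewrite /coform -[v in RHS](coordK _ jx) linear_sum.
by apply: eq_bigr => i _; rewrite linearZ mxE mulrC.
Qed.

Lemma co_image_open (c : chart M) (W : set M) : open W ->
  open (co c @` (cdom c `&` W)).
Proof.
move=> oW.
rewrite [X in open X](_ : _ = co c @` (cdom c `&` cdom c) `&` pt c @^-1` W).
  rewrite openE => y [[x [cx _] <-{y}]] /=; rewrite coK// => Wx.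
  have oc := @co_open _ _ _ M c c.
  apply: filterI; first by apply: open_nbhs_nbhs; split => //; exists x.
  have := @pt_continuous _ _ M c (co c x) (ex_intro2 _ _ x cx erefl).
  by apply; rewrite coK//; apply: open_nbhs_nbhs.
apply/seteqP; split=> [_ [x [cx Wx] <-]|y [[x [cx _] <-{y}]]] /=.
  by rewrite coK//; split => //; exists x.
by rewrite coK// => Wx; exists x.
Qed.

Lemma dual_co_image c c' : dual_co c @` (dual_cdom c `&` dual_cdom c') =
  [set y | (co c.1 @` (cdom c.1 `&` (vdom c.2 `&` (cdom c'.1 `&` vdom c'.2))))
             (lsubmx y)].
Proof.
apply/seteqP; split=> [_ [p [[cp jp] [cp' jp']] <-] /=|y /=].
  by rewrite row_mxKl; exists (dual_proj p).
move=> [x [cx [jx [cx' jx']]] xy].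
have px : pt c.1 (lsubmx y) = x by rewrite -xy coK.
exists (dual_pt c y).
  by rewrite /dual_cdom /dual_pt /dual_proj /= px.
rewrite /dual_co /dual_pt /dual_proj /dual_form /=.
rewrite -[RHS]hsubmxK; congr row_mx; first by rewrite px.
by apply/rowP => i; rewrite mxE coform_frame// px.
Qed.

Lemma dual_co_open c c' :
  open (dual_co c @` (dual_cdom c `&` dual_cdom c')).
Proof.
rewrite dual_co_image.
apply: (@open_comp _ _ (lsubmx : 'rV[R]_(m + n) -> 'rV[R]_m)).
  by move=> y _; exact: continuous_lsubmx.
apply: co_image_open; apply: openI; first exact: vdom_open.
by apply: openI; [exact: cdom_open|exact: vdom_open].
Qed.

Lemma dual_co_smooth c c' l :
  smooth_on (dual_co c @` (dual_cdom c `&` dual_cdom c'))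
            (fun y => dual_co c' (dual_pt c y) 0 l).
Proof.
have oU := @dual_co_open c c'; rewrite dual_co_image in oU *.
case: (split_ordP l) => i ->.
  rewrite [X in smooth_on _ X](_ : _ =
      fun y : 'rV[R]_(m + n) => co c'.1 (pt c.1 (lsubmx y)) 0 i); last first.
    by apply/funext => y; rewrite /dual_co row_mxEl.
  apply: (@smooth_on_lsubmx _ _ _ _ (fun y => co c'.1 (pt c.1 y) 0 i)).
  apply: smooth_on_sub (@co_smooth _ _ _ M c.1 c'.1 i).
  by move=> _ [x [cx [_ [cx' _]]] <-]; exists x.
rewrite [X in smooth_on _ X](_ : _ = fun y : 'rV[R]_(m + n) =>
    \sum_(k < n) y 0 (rshift m k) *
      coord c.2 (pt c.1 (lsubmx y)) (frame c'.2 (pt c.1 (lsubmx y)) i) 0 k);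
    last first.
  apply/funext => y; rewrite /dual_co row_mxEr mxE.
  by apply: eq_bigr => k _; rewrite mxE.
apply: smooth_on_sum => // k; apply: smooth_onM => //.
  exact: smooth_on_coord.
apply: (@smooth_on_lsubmx _ _ _ _ (fun y =>
  coord c.2 (pt c.1 y) (frame c'.2 (pt c.1 y) i) 0 k)).
apply: smooth_on_sub (@coord_smooth _ _ _ _ A c'.2 c.2 i k c.1).
by move=> _ [x [cx [jx [cx' jx']]] <-]; exists x.
Qed.

Definition dual_atlas : atlas R (m + n) dual_total :=
  Atlas dual_chart_atP dual_coK dual_co_open dual_co_smooth.

Definition linfun (mu : forall x, fiber A x) : dual_total -> R :=
  fun p => dual_form p (mu (dual_proj p)).

Definition linear_function (F : dual_total -> R) : Prop :=
  exists2 mu, smooth_section mu & F = linfun mu.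

Definition basic_function (F : dual_total -> R) : Prop :=
  exists2 f, smooth_fun M f & F = f \o dual_proj.

(* The bracket is a total operation on arbitrary sections, constrained on the
   smooth ones only. *)
Record lie_algebroid := LieAlgebroid {
  abr : (forall x, fiber A x) -> (forall x, fiber A x) -> forall x, fiber A x;
  anchor : forall x, fiber A x -> tangent M x;
  abr_smooth : forall mu eta, smooth_section mu -> smooth_section eta ->
    smooth_section (abr mu eta);
  abr_linear : forall (a : R) mu mu' eta,
    smooth_section mu -> smooth_section mu' -> smooth_section eta ->
    forall x, abr (fun y => a *: mu y + mu' y) eta x
              = a *: abr mu eta x + abr mu' eta x;
  abr_anti : forall mu eta, smooth_section mu -> smooth_section eta ->
    forall x, abr mu eta x = - abr eta mu x;
  abr_jacobi : forall mu eta theta,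
    smooth_section mu -> smooth_section eta -> smooth_section theta ->
    forall x, abr mu (abr eta theta) x + abr eta (abr theta mu) x
              + abr theta (abr mu eta) x = 0;
  anchor_linear : forall x (c : chart M), cdom c x ->
    linear (fun v : fiber A x => anchor v c);
  anchor_smooth : forall (c : chart M) (j : triv A) i l,
    smooth_fun_on M (cdom c `&` vdom j)
      (fun x => anchor (frame j x i) c 0 l);
  anchor_abr : forall mu eta, smooth_section mu -> smooth_section eta ->
    eq_field1 (fun x c => anchor (abr mu eta x) c)
      (lie_bracket (fun x (c : chart M) => anchor (mu x) c)
                   (fun x c => anchor (eta x) c));
  abr_leibniz : forall mu eta f,
    smooth_section mu -> smooth_section eta -> smooth_fun M f ->
    forall x, abr mu (fun y => f y *: eta y) x
              = f x *: abr mu eta x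
                + vf_apply (fun y (c : chart M) => anchor (mu y) c) f x *: eta x
}.

Definition anchor_apply (D : lie_algebroid) (mu : forall x, fiber A x) :
  (M -> R) -> M -> R :=
  vf_apply (fun y (c : chart M) => anchor D (mu y) c).

Definition cocycle (D : lie_algebroid) (phi : forall x, {scalar fiber A x}) :
    Prop :=
  smooth_dual_section phi /\
  forall mu eta, smooth_section mu -> smooth_section eta ->
  forall x, phi x (abr D mu eta x)
    = anchor_apply D mu (fun y => phi y (eta y)) x
      - anchor_apply D eta (fun y => phi y (mu y)) x.

(* The structure functions involve the brackets of the local sections e_i,
   whereas [abr] acts on global ones: e_i is replaced by a global smooth
   section which coincides with it near x. Such a section exists (cut-off
   functions) and, the bracket being local, the choice is irrelevant. *)
Definition frame_ext (j : triv A) (x : M) (i : 'I_n) : forall y, fiber A y :=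
  if pselect (exists s, smooth_section s /\
                        \forall y \near x, s y = frame j y i)
  is left h then sval (cid h) else fun=> 0.

(* c_{i i'}^k at x *)
Definition struct_fun (D : lie_algebroid) j x i i' k : R :=
  coord j x (abr D (frame_ext j x i) (frame_ext j x i') x) 0 k.

(* rho_i^l at x *)
Definition anchor_fun (D : lie_algebroid) (c : dual_chart) x i l : R :=
  anchor D (frame c.2 x i) c.1 0 l.

Definition mu_coord (c : dual_chart) (p : dual_total) (i : 'I_n) : R :=
  dual_form p (frame c.2 (dual_proj p) i).

Definition d_x (l : 'I_m) : 'rV[R]_(m + n) := delta_mx 0 (lshift n l).
Definition d_mu (i : 'I_n) : 'rV[R]_(m + n) := delta_mx 0 (rshift m i).

Definition poisson_dual (D : lie_algebroid) : field2 dual_atlas :=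
  fun p c => let x := dual_proj p in
  \sum_(i < n) \sum_(i' < n | (i < i')%N) \sum_(k < n)
     (struct_fun D c.2 x i i' k * mu_coord c p k) *: wedge (d_mu i) (d_mu i')
  + \sum_(i < n) \sum_(l < m) anchor_fun D c x i l *: wedge (d_mu i) (d_x l).

Definition liouville : field1 dual_atlas :=
  fun p c => \sum_i mu_coord c p i *: d_mu i.

Definition vlift (phi : forall x, {scalar fiber A x}) : field1 dual_atlas :=
  fun p c => \sum_i phi (dual_proj p) (frame c.2 (dual_proj p) i) *: d_mu i.

Definition jacobi_dual2 D phi : field2 dual_atlas :=
  fun p c => poisson_dual D p c + wedge (liouville p c) (vlift phi p c).

Definition jacobi_dual1 phi : field1 dual_atlas := fun p c => - vlift phi p c.

End Bundle.

(* Main.v *)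
(* Write mu~ for the linear function of a section mu and f o pi for a basic
   function. By (C2), E(f o pi) * mu~ = E((f mu)~) - f E(mu~) is basic for every
   mu; it vanishes on the zero section, hence E(f o pi) = 0 off the zero section
   (the rank is positive) and then everywhere by continuity. By (C1) and the
   Leibniz rule, L(d mu~, d(f o pi)) * eta~ is linear for every eta, so
   L(d mu~, d(f o pi)) is constant along each ray of a fibre, hence basic; as
   before it follows that L(d(f o pi), d(g o pi)) = 0. Therefore {mu~, eta~},
   L(d mu~, d(f o pi)) and {mu~, 1} define a bracket on sections, an anchor and
   a form phi, and all the algebraic identities are instances of the Jacobi
   identity of {.,.}, for (mu~, eta~, theta~), (mu~, eta~, f o pi) and
   (mu~, eta~, 1). The components of L and E in a bundle chart are read off by
   evaluating them on global extensions, by cut-off functions, of the coordinate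
   functions and of the local frame. *)

From Pilot Require Import Defs.
From HB Require Import structures.
From mathcomp Require Import all_boot all_order all_algebra.
From mathcomp Require Import all_classical all_reals all_analysis.
From mathcomp Require Import ring lra.
(* Again, since [vector] and [derive] also export [coord], [linfun] and
   [jacobian]. *)
Import Pilot.Defs.

Set Implicit Arguments.
Unset Strict Implicit.
Unset Printing Implicit Defensive.

Import Order.TTheory GRing.Theory Num.Theory.
Import numFieldNormedType.Exports.
Local Open Scope classical_set_scope.
Local Open Scope ring_scope.

(** * Differentiability of smooth functions *)

Section Calculus.
Context {R : realType} {d : nat}.
Implicit Types (U : set 'rV[R]_d) (f g : 'rV[R]_d -> R) (x v w h : 'rV[R]_d).

(** Positive rank is essential: in rank 0 the only linear function is 0, so (C1) and (C2) hold for
    every Jacobi structure on M, while the conclusion forces both tensors to vanish. The zero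
    section is the main tool for descending to M. Restriction to it is smooth, and it recovers a
    basic function from its pullback, so smoothness of the anchor and of phi needs no patching.
    Moreover a linear function vanishes along it, hence only its fibre derivatives survive there,
    and the values read off depend on the section only through its value at the point. The Jacobi
    identity of the bracket is not a hypothesis: what is given are equations between components of
    Schouten brackets. It is derived as an algebraic identity between 2-jets at one point, whose
    analytic input is the symmetry of second derivatives. Since {mu~, f o pi} is the pullback of
    rho(mu) f + f phi(mu), the form phi also enters the Jacobi identity for (mu~, eta~, f o pi). The
    cocycle identity therefore comes before the homomorphism property of the anchor. *)

Lemma rV_coord_le v i : `|v 0 i| <= `|v|.
Proof.
rewrite [leRHS]/Num.Def.normr/= mx_normrE.
exact: (le_bigmax _ (fun ij : 'I_1 * 'I_d => `|v ij.1 ij.2|) (0, i)).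
Qed.

Lemma rV_norm_le v (e : R) : 0 <= e -> (forall i, `|v 0 i| <= e) -> `|v| <= e.
Proof.
move=> e0 ve; rewrite [leLHS]/Num.Def.normr/= mx_normrE bigmax_le// => -[i j] _ /=.
by rewrite ord1.
Qed.

Lemma is_derive_line f x v (t : R) : derivable f (t *: v + x) v ->
  is_derive t 1 (fun s => f (s *: v + x)) ('D_v f (t *: v + x)).
Proof.
move=> df; have E : (fun h : R => h^-1 *: (f (h *: v + (t *: v + x)) - f (t *: v + x)))
    = (fun h : R => h^-1 *: (f ((h *: (1 : R) + t) *: v + x) - f (t *: v + x))).
  by apply/funext => h; rewrite [_ *: 1]mulr1 scalerDl addrA.
by apply: DeriveDef; [rewrite /derivable -E|rewrite /derive -E].
Qed.

Lemma MVT_line f x v (t : R) :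
  (forall s : R, `|s| <= `|t| -> derivable f (s *: v + x) v) ->
  exists2 s : R, `|s| <= `|t| & f (t *: v + x) - f x = t * 'D_v f (s *: v + x).
Proof.
(* The sign of t is arbitrary, so the segment runs from the smaller to the larger of 0 and t. *)
move=> df; pose a := Num.min 0 t; pose b := Num.max 0 t.
have ab : a <= b by rewrite /a /b; case: (leP 0 t) => // /ltW.
have bnd s : s \in `[a, b] -> `|s| <= `|t|.
  rewrite in_itv/= /a /b; case: (leP 0 t) => t0 /andP[s1 s2].
    by rewrite !ger0_norm.
  by rewrite (ltr0_norm t0) ler0_norm// lerN2.
have D s : s \in `[a, b] -> is_derive s 1 (fun s => f (s *: v + x)) ('D_v f (s *: v + x)).
  by move=> sab; apply/is_derive_line/df/bnd.
have cf : {within `[a, b], continuous (fun s : R => f (s *: v + x))}.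
  by apply: derivable_within_continuous => s /D[].
have D' s (sab : s \in `]a, b[) := D s (subset_itv_oo_cc sab).
have [s sab] := @MVT_segment R (fun s : R => f (s *: v + x))
  (fun s => 'D_v f (s *: v + x)) a b ab D' cf.
rewrite /a /b => e; exists s; first exact: bnd.
move: e; case: (leP 0 t) => t0; rewrite !scale0r !add0r ?subr0 ?sub0r mulrC => //.
by move=> /(congr1 -%R); rewrite opprB => ->; rewrite mulNr opprK.
Qed.

Lemma smooth_onP U f : smooth_on U f ->
  [/\ forall x, U x -> {for x, continuous f},
      forall i x, U x -> derivable f x (delta_mx 0 i) &
      forall i, smooth_on U (partial i f)].
Proof.
by case/smooth_onS => cf sf; split=> // i; [move=> x|]; case: (sf i) => // + _; apply.
Qed.

(** The corners of a staircase from 0 to h whose steps are parallel to the axes. *)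
Let cut k h : 'rV[R]_d := \row_i (if (i < k)%N then h 0 i else 0).

(** Continuous partial derivatives give a total derivative: the increment of f telescopes along the
    staircase [cut], the mean value theorem turns each step into a partial derivative at a point
    within [|h|] of x, and continuity compares it with the one at x. *)
Lemma smooth_differentiable U f x : open U -> smooth_on U f -> U x ->
  differentiable f x.
Proof.
move=> oU /smooth_onP[cf df sf] Ux.
pose l h := \sum_i h 0 i * partial i f x.
have lin_l : linear l.
  move=> k u v; rewrite /l scaler_sumr -big_split/=; apply: eq_bigr => i _.
  by rewrite !mxE mulrDl -mulrA.
pose L : {linear 'rV[R]_d -> R} := HB.pack l (GRing.isLinear.Build _ _ _ _ _ lin_l).
have cL : continuous L.
  move=> y; apply: (@smooth_on_sum R d setT d (fun i h => h 0 i * partial i f x) openT _ 0%N) => // i.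
  by apply: smooth_onM; [exact: openT|exact: smooth_on_coord|exact: smooth_on_cst].
have expand : f \o shift x = cst (f x) + L +o_ (0 : 'rV[R]_d) id.
  (* The d steps contribute at most [e' * |h|] each; the denominator d + 1 also covers d = 0. *)
  apply/eqaddoP => e e0; pose e' := e / d.+1%:R.
  have e'0 : 0 < e' by rewrite divr_gt0.
  have /nbhs_ballP[r /= r0 rP] : \forall w \near x, U w /\ forall i, `|partial i f x - partial i f w| <= e'.
    apply: filterI; first exact: open_nbhs_nbhs.
    have near_i (i : 'I_d) : \forall w \near x, `|partial i f x - partial i f w| <= e'.
      by have [/(_ x Ux)/cvgrPdist_le + _ _] := smooth_onP (sf i); apply.
    exact: (filter_forall _ near_i).
  suff main h : `|h| < r ->
      `|(f \o shift x - (cst (f x) + L)) h| <= e * `|h|.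
    apply/nbhs_ballP; exists r => // h.
    rewrite -ball_normE /ball_/= sub0r normrN; exact: main.
  move=> hr.
  have inU w : `|w| <= `|h| -> U (w + x) /\ forall i, `|partial i f x - partial i f (w + x)| <= e'.
    move=> wh; apply: rP; rewrite -ball_normE /ball_/=.
    by rewrite opprD addrCA subrr addr0 normrN (le_lt_trans wh).
  have cutS (i : 'I_d) : cut i.+1 h = h 0 i *: delta_mx 0 i + cut i h.
    apply/rowP => j; rewrite !mxE eqxx/= ltnS leq_eqVlt.
    case: ltngtP => [ji|ij|/val_inj ->]; last by rewrite eqxx mulr1 addr0.
      by rewrite -val_eqE/= (ltn_eqF ji) mulr0 add0r.
    by rewrite -val_eqE/= (gtn_eqF ij) mulr0 add0r.
  have step (i : 'I_d) :
      `|f (cut i.+1 h + x) - f (cut i h + x) - h 0 i * partial i f x| <= e' * `|h|.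
    have small (s : R) : `|s| <= `|h 0 i| -> `|s *: delta_mx 0 i + cut i h| <= `|h|.
      move=> sh; apply: rV_norm_le => // j; rewrite !mxE eqxx/=.
      have [->|ji] := eqVneq j i.
        by rewrite ltnn mulr1 addr0 (le_trans sh) ?rV_coord_le.
      rewrite mulr0 add0r; case: ifP => _; first exact: rV_coord_le.
      by rewrite normr0.
    have [s sh E] : exists2 s : R, `|s| <= `|h 0 i| &
        f (cut i.+1 h + x) - f (cut i h + x) =
        h 0 i * partial i f (s *: delta_mx 0 i + cut i h + x).
      rewrite cutS -addrA; have [s sh|s sh E] := @MVT_line f (cut i h + x) (delta_mx 0 i) (h 0 i).
        by apply: df; rewrite addrA; have [] := inU _ (small s sh).
      by exists s => //; rewrite E addrA.
    rewrite E -mulrBr normrM mulrC ler_pM// ?rV_coord_le// distrC.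
    by have [_] := inU _ (small s sh); apply.
  have tele : (f \o shift x - (cst (f x) + L)) h =
      \sum_(i < d) (f (cut i.+1 h + x) - f (cut i h + x) - h 0 i * partial i f x).
    rewrite sumrB -(big_mkord xpredT (fun i => f (cut i.+1 h + x) - f (cut i h + x))).
    rewrite telescope_sumr// (_ : cut d h = h); last first.
      by apply/rowP => i; rewrite mxE ltn_ord.
    rewrite (_ : cut 0 h = 0); last by apply/rowP => i; rewrite !mxE.
    rewrite add0r -addrA -opprD.
    by [].
  rewrite tele (le_trans (ler_norm_sum _ _ _))//.
  rewrite (le_trans (ler_sum _ (fun i _ => step i)))//.
  rewrite sumr_const card_ord -[_ *+ d]mulr_natr mulrAC ler_wpM2r//.
  by rewrite -mulrA ler_piMr ?(ltW e0)// mulrC ler_pdivrMr// mul1r ler_nat.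
have dL : 'd f x = L :> ('rV[R]_d -> R) by exact: diff_unique.
by apply/diff_locallyP; rewrite dL; split.
Qed.

Lemma derive_partial f x v : differentiable f x ->
  'D_v f x = \sum_i v 0 i * partial i f x.
Proof.
move=> df; rewrite deriveE// {1}[v]row_sum_delta linear_sum; apply: eq_bigr => i _.
by rewrite linearZ /partial deriveE.
Qed.

End Calculus.

(** * Local properties and symmetry of second derivatives *)

Section Locality.
Context {R : realType} {d : nat}.
Implicit Types (U V : set 'rV[R]_d) (f g : 'rV[R]_d -> R) (x : 'rV[R]_d).

Lemma near_eq_partial i f g x : (\near x, f x = g x) ->
  \near x, partial i f x = partial i g x.
Proof.
move=> /nbhs_interior; rewrite /interior; apply: filterS => y fg.
exact: near_eq_derive.
Qed.

Lemma near_eq_smooth f g x : (\near x, f x = g x) ->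
  smooth_on [set x] f -> smooth_on [set x] g.
Proof.
move=> + + k; elim: k f g => [|k IH] f g fg fs.
  have fgx : f x = g x by exact: (nbhs_singleton fg).
  move=> _ ->; rewrite /prop_for /continuous_at -fgx.
  by apply: cvg_trans (fs 0%N x erefl); apply: (@near_eq_cvg _ _ (nbhs x)).
move/smooth_onS: fs => [_ fs] i; have [df Df] := fs i; split.
  by move=> _ ->; apply: near_eq_derivable fg (df _ _).
by apply: IH Df; exact: near_eq_partial.
Qed.

(** Every clause of [Ck_on] quantifies over the points of U, and [partial] does not refer to U, so
    smoothness splits into conditions at single points. *)
Lemma smooth_on_point U f : (forall x, U x -> smooth_on [set x] f) -> smooth_on U f.
Proof.
move=> + k; elim: k f => [|k IH] f fs; first by move=> x Ux; exact: (fs x Ux 0%N).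
move=> i; split=> [x Ux|].
  by have /smooth_onP[_ + _] := fs x Ux; apply.
by apply: IH => x Ux; have /smooth_onP[_ _] := fs x Ux; apply.
Qed.

Lemma smooth_on_local U f :
  (forall x, U x -> exists V g, [/\ V x, smooth_on V g & \near x, g x = f x]) ->
  smooth_on U f.
Proof.
move=> loc; apply: smooth_on_point => x /loc[V [g [Vx sg gf]]].
apply: near_eq_smooth gf _.
by apply: smooth_on_sub sg => _ ->.
Qed.

Lemma eq_smooth_on U f g : open U -> (forall x, U x -> f x = g x) ->
  smooth_on U f -> smooth_on U g.
Proof. by move=> oU fg fs k; apply: eq_Ck_on fg (fs k). Qed.

Lemma smooth_onD U f g : open U -> smooth_on U f -> smooth_on U g ->
  smooth_on U (fun x => f x + g x).
Proof. by move=> oU fs gs k; apply: Ck_onD. Qed.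

Lemma smooth_onN U f : open U -> smooth_on U f -> smooth_on U (fun x => - f x).
Proof.
move=> oU fs; have E : (fun x => -1 * f x) = (fun x => - f x).
  by apply/funext => x; rewrite mulN1r.
by rewrite -E; apply: smooth_onM => //; exact: smooth_on_cst.
Qed.

Lemma smooth_onB U f g : open U -> smooth_on U f -> smooth_on U g ->
  smooth_on U (fun x => f x - g x).
Proof. by move=> oU fs gs; apply: smooth_onD => //; exact: smooth_onN. Qed.

End Locality.

(** * Chain rules along lines *)

Lemma derive_line (R : realType) (V W : normedModType R) (f : V -> W) (x v : V) :
  'D_v f x = 'D_1 (fun t : R => f (t *: v + x)) 0.
Proof.
rewrite /derive; set g1 := fun h => h^-1 *: _; set g2 := fun h => h^-1 *: _.
suff -> : g1 = g2 by [].
apply/funext => h; rewrite /g1 /g2/=.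
by rewrite addr0 scale0r add0r [_ *: 1]mulr1.
Qed.

Lemma is_derive_comp1 (R : realType) (V : normedModType R) (phi : R -> R) (a : R)
    (q : V -> R) (x v : V) :
  derivable q x v -> is_derive (q x) 1 phi a ->
  is_derive x v (fun y => phi (q y)) (a * 'D_v q x).
Proof.
move=> /derivable1P dq Dphi.
have Dq : is_derive (0 : R) 1 (fun t : R => q (t *: v + x)) ('D_v q x).
  by apply: DeriveDef => //; rewrite -derive_line.
have D : is_derive (0 : R) 1 (phi \o (fun t : R => q (t *: v + x))) (a * 'D_v q x).
  by apply: is_derive1_comp; rewrite scale0r add0r.
apply: DeriveDef; first by apply/derivable1P; exact: (@ex_derive _ _ _ _ _ _ _ D).
by rewrite derive_line; exact: (@derive_val _ _ _ _ _ _ _ D).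
Qed.

(** The inner map is only assumed derivable in the direction v. Along the line through x in that
    direction it becomes a function of one real variable, for which derivability is
    differentiability. *)
Lemma is_derive_comp_rV (R : realType) (V : normedModType R) (d : nat)
    (f : 'rV[R]_d -> R) (q : V -> 'rV[R]_d) (x v : V) :
  (forall l, derivable (fun y => q y 0 l) x v) -> differentiable f (q x) ->
  is_derive x v (fun y => f (q y))
    (\sum_l 'D_v (fun y => q y 0 l) x * partial l f (q x)).
Proof.
move=> dq df; pose g (t : R) := q (t *: v + x).
have dqx : derivable q x v by apply/derivable_mxP => i j; rewrite ord1.
have dg : differentiable g 0 by exact: (proj1 (derivable1_diffP g 0) (proj1 (derivable1P q x v) dqx)).
have g0 : g 0 = q x by rewrite /g scale0r add0r.
have df' : differentiable f (g 0) by rewrite g0.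
have dfg : differentiable (f \o g) 0 by exact: differentiable_comp.
have dfq : derivable (fun y => f (q y)) x v.
  exact: (proj2 (derivable1P _ _ _) (proj2 (derivable1_diffP _ _) dfg)).
apply: DeriveDef => //.
rewrite derive_line -/(f \o g) deriveE// diff_comp//= g0.
have -> : 'd g 0 1 = 'D_v q x by rewrite derive_line -(deriveE (1 : R) dg).
rewrite -deriveE// derive_partial//; apply: eq_bigr => l _.
by rewrite derive_mx// mxE.
Qed.

Section Schwarz.
Context {R : realType} {d : nat}.
Implicit Types (U : set 'rV[R]_d) (f : 'rV[R]_d -> R) (x v : 'rV[R]_d).

Lemma is_derive_translate f x v (a : 'rV[R]_d) : derivable f (a + x) v ->
  is_derive x v (fun y => f (a + y)) ('D_v f (a + x)).
Proof.
move=> df; have E : (fun h : R => h^-1 *: (f (h *: v + (a + x)) - f (a + x))) =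
    (fun h : R => h^-1 *: (f (a + (h *: v + x)) - f (a + x))).
  by apply/funext => h; rewrite addrCA.
by apply: DeriveDef; [rewrite /derivable -E|rewrite /derive -E].
Qed.

(** The mean value theorem is applied twice: to the difference of f in direction j, as a function
    along direction i, and then to the resulting difference of [partial i f] along direction j. *)
Lemma second_difference U f x i j (t : R) :
  (forall a b : R, `|a| <= `|t| -> `|b| <= `|t| ->
     U (b *: delta_mx 0 j + (a *: delta_mx 0 i + x))) ->
  smooth_on U f ->
  exists a b : R, [/\ `|a| <= `|t|, `|b| <= `|t| &
    f (t *: delta_mx 0 j + (t *: delta_mx 0 i + x)) - f (t *: delta_mx 0 i + x)
    - (f (t *: delta_mx 0 j + x) - f x)
    = t * t * partial j (partial i f) (b *: delta_mx 0 j + (a *: delta_mx 0 i + x))].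
Proof.
move=> inU /smooth_onP[_ df sf]; set u : 'rV[R]_d := delta_mx 0 i; set w : 'rV[R]_d := delta_mx 0 j.
have inU0 (a : R) : `|a| <= `|t| -> U (a *: u + x).
  by move=> ta; have := inU a 0 ta; rewrite normr0 scale0r add0r; exact.
pose g y := f (t *: w + y) - f y.
have Dg (s : R) : `|s| <= `|t| -> is_derive (s *: u + x) u g
    (partial i f (t *: w + (s *: u + x)) - partial i f (s *: u + x)).
  move=> st; apply: is_deriveB.
    by apply: is_derive_translate; apply: df; exact: inU.
  by apply: derivableP; apply: df; exact: inU0.
have [|a ta Ea] := @MVT_line _ _ g x u t; first by move=> s /Dg[].
have [_ dDf _] := smooth_onP (sf i).
have [|b tb Eb] := @MVT_line _ _ (partial i f) (a *: u + x) w t.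
  by move=> s st; apply: dDf; exact: inU.
exists a, b; split=> //.
by rewrite -[LHS]/(g (t *: u + x) - g x) Ea; case: (Dg a ta) => _ ->; rewrite Eb mulrA.
Qed.

(** The second difference is symmetric in i and j, so both mixed derivatives take a common value at
    points arbitrarily close to x; continuity brings this back to x. *)
Lemma partialC U f x i j : open U -> smooth_on U f -> U x ->
  partial i (partial j f) x = partial j (partial i f) x.
Proof.
move=> oU sf Ux; apply/eqP; rewrite -subr_eq0 -normr_le0; apply/ler_addgt0Pl => e e0.
rewrite addr0.
have [_ _ s1f] := smooth_onP sf.
have cts k l : {for x, continuous (partial k (partial l f))}.
  by have [_ _ /(_ k)/smooth_onP[+ _ _]] := smooth_onP (s1f l); apply.
have near_kl k l : \forall y \near x,
    `|partial k (partial l f) x - partial k (partial l f) y| <= e / 2.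
  by have /cvgrPdist_le := cts k l; apply; rewrite divr_gt0.
have /nbhs_ballP[r /= r0 rP] : \forall y \near x, U y /\
    (`|partial i (partial j f) x - partial i (partial j f) y| <= e / 2 /\
     `|partial j (partial i f) x - partial j (partial i f) y| <= e / 2).
  apply: filterI; first exact: open_nbhs_nbhs.
  by apply: filterI; exact: near_kl.
(* Two displacements of length at most t stay within r / 2 of x, hence inside the ball. *)
pose t := r / 4.
have t0 : 0 < t by rewrite divr_gt0.
have inball (a b : R) (k l : 'I_d) : `|a| <= `|t| -> `|b| <= `|t| ->
    ball x r (b *: delta_mx 0 l + (a *: delta_mx 0 k + x)).
  move=> at_ bt; rewrite -ball_normE /ball_/= addrA opprD addrCA subrr addr0 normrN.
  have nd (c : R) (l' : 'I_d) : `|c *: (delta_mx 0 l' : 'rV[R]_d)| <= `|c|.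
    apply: rV_norm_le => // j'; rewrite !mxE eqxx/= normrM.
    by case: (j' == l'); rewrite ?normr1 ?normr0 ?mulr1 ?mulr0.
  rewrite (le_lt_trans (ler_normD _ _))// (le_lt_trans (lerD (nd _ _) (nd _ _)))//.
  rewrite (le_lt_trans (lerD bt at_))// gtr0_norm// /t; lra.
have [|a [b [ta tb E1]]] := @second_difference U f x i j t _ sf.
  by move=> a b ta tb; have [] := rP _ (inball a b i j ta tb).
have [|a' [b' [ta' tb' E2]]] := @second_difference U f x j i t _ sf.
  by move=> a' b' ta' tb'; have [] := rP _ (inball a' b' j i ta' tb').
have [_ [_ b1]] := rP _ (inball a b i j ta tb).
have [_ [b2 _]] := rP _ (inball a' b' j i ta' tb').
have E : partial j (partial i f) (b *: delta_mx 0 j + (a *: delta_mx 0 i + x))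
       = partial i (partial j f) (b' *: delta_mx 0 i + (a' *: delta_mx 0 j + x)).
  apply: (@mulfI _ (t * t)); first by rewrite mulf_neq0 ?gt_eqF.
  apply: etrans (esym E1) _; apply: etrans _ E2.
  rewrite [t *: delta_mx 0 i + (t *: delta_mx 0 j + x)]addrCA.
  by move: (f _) (f _) (f _) (f _) => a1 a2 a3 a4; rewrite !opprB addrACA [RHS]addrACA [- a2 + _]addrC.
rewrite -{}E in b2; move: b1 b2.
move: (partial i _ x) (partial j _ x) (partial j _ (b *: _ + _)) => P Q S b1 b2.
have -> : P - Q = (P - S) - (Q - S) by rewrite opprB addrA subrK.
by apply: le_trans (ler_normB _ _) _; rewrite (splitr e); exact: lerD.
Qed.

End Schwarz.

(** * Cut-off functions *)

Lemma is_derive_exprn (R : realType) (V : normedModType R) (f : V -> R) (df : R)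
    (x v : V) (n : nat) : is_derive x v f df ->
  is_derive x v (fun y => f y ^+ n) (n%:R * f x ^+ n.-1 * df).
Proof.
move=> Df; have -> : (fun y => f y ^+ n) = f ^+ n.
  by apply/funext => y; rewrite exprfctE.
exact: is_deriveX.
Qed.

Lemma is_derive_inv (R : realType) (V : normedModType R) (f : V -> R) (df : R)
    (x v : V) : f x != 0 -> is_derive x v f df ->
  is_derive x v (fun y => (f y)^-1) (- (f x)^-1 ^+ 2 * df).
Proof.
move=> fx0 [dfx <-]; apply: DeriveDef; first exact: derivableV.
by rewrite deriveV// exprVn.
Qed.

Section Plateau.
Context {R : realType}.
Implicit Types (t : R) (k : nat).

(* t^-k exp(-1/t), a family closed under differentiation up to linear
   combinations. *)
Definition flat k t : R := if 0 < t then t^-1 ^+ k * expR (- t^-1) else 0.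

Lemma flat_le0 k t : t <= 0 -> flat k t = 0.
Proof. by move=> t0; rewrite /flat ltNge t0. Qed.

Lemma flat_ge0 k t : 0 <= flat k t.
Proof.
by rewrite /flat; case: ifP => // t0; rewrite mulr_ge0 ?exprn_ge0 ?invr_ge0 ?expR_ge0// ltW.
Qed.

Lemma flat_gt0 t : 0 < t -> 0 < flat 0 t.
Proof. by move=> t0; rewrite /flat t0 expr0 mul1r expR_gt0. Qed.

(** This is s^(k+1) / (k+1)! <= exp s at s = 1/t. The spare factor t is what makes the function tend
    to 0 at the origin. *)
Lemma flat_le k t : `|flat k t| <= (k.+1)`!%:R * `|t|.
Proof.
rewrite ger0_norm ?flat_ge0// /flat; case: ifPn => [t0|_]; last by rewrite mulr_ge0.
rewrite (gtr0_norm t0) expRN ler_pdivrMr ?expR_gt0//.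
have : t^-1 ^+ k.+1 / (k.+1)`!%:R <= expR t^-1.
  by rewrite (le_trans _ (expR_ge1Dxn k _)) ?lerDr// invr_ge0 ltW.
rewrite ler_pdivrMr ?ltr0n ?fact_gt0// => bound.
have -> : t^-1 ^+ k = t * t^-1 ^+ k.+1 by rewrite exprS mulrA divff ?mul1r ?gt_eqF.
by rewrite -mulrA mulrCA ler_pM2l// [leRHS]mulrC.
Qed.

Lemma flatS k t : t^-1 * flat k t = flat k.+1 t.
Proof. by rewrite /flat; case: ifP => _; rewrite ?mulr0// exprS mulrA. Qed.

Lemma is_derive_flat k t :
  is_derive t 1 (flat k) (flat k.+2 t - k%:R * flat k.+1 t).
Proof.
have [t0|t0|->] := ltgtP t 0.
- rewrite !flat_le0 ?ltW// mulr0 subr0.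
  apply: (@near_eq_is_derive _ _ _ (cst 0)).
  near=> s; rewrite flat_le0//; apply: ltW; near: s; exact: lt_nbhsl.
- suff D : is_derive t 1 (fun s => s^-1 ^+ k * expR (- s^-1))
      (flat k.+2 t - k%:R * flat k.+1 t).
    apply: near_eq_is_derive D; near=> s; rewrite /flat ifT//.
    by near: s; exact: lt_nbhsr.
  have DV : is_derive t 1 (fun s : R => s^-1) (- t^-1 ^+ 2 * 1).
    by apply: (@is_derive_inv _ _ id); rewrite ?gt_eqF.
  have DX := is_derive_exprn k DV.
  have DE : is_derive t 1 (fun s : R => expR (- s^-1))
      (expR (- t^-1) * - (- t^-1 ^+ 2 * 1)).
    have DN : is_derive t 1 (- (fun s : R => s^-1)) (- (- t^-1 ^+ 2 * 1)).
      exact: is_deriveN.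
    exact: (@is_derive1_comp _ expR (- (fun s : R => s^-1)) t _ _
      (is_derive_expR _) DN).
  apply: is_derive_eq (is_deriveM DX DE) _.
  rewrite /flat t0 /GRing.scale/=; move: t^-1 (expR _) => s e.
  case: k {DX} => [|k]; rewrite ?exprS ?expr0 -?natr1; ring.
(* At the origin the difference quotient of [flat k] is [flat k.+1], which the linear bound sends to
   0. *)
- have flat_dq (h : R) : h^-1 *: (flat k (h *: 1 + 0) - flat k 0) = flat k.+1 h.
    by rewrite [h *: 1]mulr1 addr0 (flat_le0 _ (lexx 0)) subr0 -flatS.
  have lim0 : (fun h : R => h^-1 *: (flat k (h *: 1 + 0) - flat k 0)) @ 0^' --> (0 : R).
    rewrite (_ : (fun h : R => _) = flat k.+1); last by apply/funext.
    apply/cvgrPdist_le => e e0; near=> h; rewrite sub0r normrN.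
    rewrite (le_trans (flat_le _ _))// mulrC -ler_pdivlMr ?ltr0n ?fact_gt0//.
    apply: ltW; near: h; apply: dnbhs0_lt.
    by rewrite divr_gt0 ?ltr0n ?fact_gt0.
  rewrite !(flat_le0 _ (lexx 0)) mulr0 subr0.
  by apply: DeriveDef; [apply/cvg_ex; exists 0|apply/cvg_lim].
Unshelve. all: by end_near. Qed.

Context {d : nat}.
Implicit Types (U : set 'rV[R]_d) (q f g s : 'rV[R]_d -> R).

Lemma smooth_flat U q : open U -> smooth_on U q -> smooth_on U (fun x => flat 0 (q x)).
Proof.
(* The extra smooth factor [s] makes the claim stable under differentiation. *)
move=> oU sq; suff main n k s : smooth_on U s -> Ck_on n U (fun x => flat k (q x) * s x).
  move=> n; apply: (eq_Ck_on oU _ (main n 0%N _ (smooth_on_cst U 1))) => x _.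
  by rewrite mulr1.
have [cq dq s1q] := smooth_onP sq.
elim: n k s => [|n IH] k s ss.
  have [cs _ _] := smooth_onP ss.
  move=> x Ux; apply: continuousM; last exact: cs.
  apply: (@continuous_comp _ _ _ q (flat k)); first exact: cq.
  apply/differentiable_continuous/derivable1_diffP.
  by case: (is_derive_flat k (q x)).
have [_ ds s1s] := smooth_onP ss.
have Dx i x : U x -> is_derive x (delta_mx 0 i) (fun x => flat k (q x) * s x)
    (flat k.+2 (q x) * (partial i q x * s x) +
     (flat k.+1 (q x) * (- k%:R * partial i q x * s x) + flat k (q x) * partial i s x)).
  move=> Ux; have D1 := is_derive_comp1 (dq i x Ux) (is_derive_flat k (q x)).
  apply: is_derive_eq (is_deriveM D1 (derivableP (ds i x Ux))) _.
  rewrite /GRing.scale/= /partial.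
  move: ('D__ s x) ('D__ q x) (flat k.+2 _) (flat k.+1 _) (flat k _) (s x) => *; ring.
move=> i; split=> [x /(Dx i)[]//|].
apply: (eq_Ck_on oU (fun x Ux => esym (@derive_val _ _ _ _ _ _ _ (Dx i x Ux)))).
apply: Ck_onD => //; first by apply: IH; exact: smooth_onM.
apply: Ck_onD => //; apply: IH => //; apply: smooth_onM => //; apply: smooth_onM => //.
exact: smooth_on_cst.
Qed.

(** The induction runs over all products g^-k s with s smooth, since the derivative of such a
    product is again one with exponent k + 1 plus one with exponent k, which merge into the
    exponent-k form after the recursion; the claim is the case k = 1, s = 1. *)
Lemma smooth_onV U g : open U -> smooth_on U g -> (forall x, U x -> g x != 0) ->
  smooth_on U (fun x => (g x)^-1).
Proof.
move=> oU sg g0; have [cg dg s1g] := smooth_onP sg.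
suff main n s k : smooth_on U s -> Ck_on n U (fun x => (g x)^-1 ^+ k * s x).
  move=> n; apply: (eq_Ck_on oU _ (main n _ 1%N (smooth_on_cst U 1))) => x _.
  by rewrite mulr1.
elim: n s k => [|n IH] s k ss.
  have [cs _ _] := smooth_onP ss.
  move=> x Ux; apply: continuousM; last exact: cs.
  apply: (@continuous_comp _ _ _ (fun x => (g x)^-1) (fun t => t ^+ k)).
    by apply: continuousV; [exact: g0|exact: cg].
  exact: exprn_continuous.
have [_ ds s1s] := smooth_onP ss.
have Dx i x : U x -> is_derive x (delta_mx 0 i) (fun x => (g x)^-1 ^+ k * s x)
    ((g x)^-1 ^+ k.+1 * (- k%:R * partial i g x * s x) + (g x)^-1 ^+ k * partial i s x).
  move=> Ux; have DV := is_derive_exprn k (is_derive_inv (g0 x Ux) (derivableP (dg i x Ux))).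
  apply: is_derive_eq (is_deriveM DV (derivableP (ds i x Ux))) _.
  rewrite /GRing.scale/= /partial; move: ('D__ s x) ('D__ g x) (g x)^-1 (s x) => *.
  case: k {DV} => [|k]; rewrite ?exprS ?expr0 -?natr1; ring.
move=> i; split=> [x /(Dx i)[]//|].
apply: (eq_Ck_on oU (fun x Ux => esym (@derive_val _ _ _ _ _ _ _ (Dx i x Ux)))).
apply: Ck_onD => //; apply: IH => //; apply: smooth_onM => //; apply: smooth_onM => //.
exact: smooth_on_cst.
Qed.

(** A smooth step from 0 to 1. The denominator never vanishes, because t and 1 - t cannot both be
    nonpositive. *)
Definition plateau t : R := flat 0 t / (flat 0 t + flat 0 (1 - t)).

Lemma plateau_le0 t : t <= 0 -> plateau t = 0.
Proof. by move=> t0; rewrite /plateau flat_le0// mul0r. Qed.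

Lemma plateau_ge1 t : 1 <= t -> plateau t = 1.
Proof.
move=> t1; rewrite /plateau [flat 0 (1 - t)]flat_le0 ?subr_le0// addr0 divff//.
by rewrite gt_eqF// flat_gt0// (lt_le_trans ltr01).
Qed.

Lemma smooth_plateau U q : open U -> smooth_on U q ->
  smooth_on U (fun x => plateau (q x)).
Proof.
move=> oU sq; apply: smooth_onM => //; first exact: smooth_flat.
apply: smooth_onV => // [|x _].
  apply: smooth_onD => //; first exact: smooth_flat.
  by apply: smooth_flat => //; apply: smooth_onB => //; exact: smooth_on_cst.
rewrite gt_eqF//; have [q0|q0] := ltP 0 (q x).
  by rewrite ltr_pwDl ?flat_gt0 ?flat_ge0.
by rewrite ltr_pwDr ?flat_ge0// flat_gt0//; lra.
Qed.

End Plateau.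

(** * The Jacobi identity on jets *)

Section JetJacobi.
Context {K : comPzRingType} {d : nat}.

(* The values at one point of the components of a 2-vector and of a vector,
   and of their first derivatives: [dL l i j] is the l-th derivative of
   [L i j]. *)
Variables (L : 'I_d -> 'I_d -> K) (dL : 'I_d -> 'I_d -> 'I_d -> K).
Variables (E : 'I_d -> K) (dE : 'I_d -> 'I_d -> K).

(** An iterated bracket differentiates each of its arguments at most twice, so 2-jets at one point
    carry everything that the Jacobi identity sees. *)
Record jet := Jet { j0 : K; j1 : 'I_d -> K; j2 : 'I_d -> 'I_d -> K }.
Implicit Types F G H : jet.

Definition pair1 (u v : 'I_d -> K) := \sum_i u i * v i.
Definition pair2 (P : 'I_d -> 'I_d -> K) (u v : 'I_d -> K) :=
  \sum_i \sum_j P i j * u i * v j.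

Definition jet_bracket F G : K :=
  pair2 L (j1 F) (j1 G) + j0 F * pair1 E (j1 G) - j0 G * pair1 E (j1 F).

Definition jet_dbracket F G (l : 'I_d) : K :=
  (pair2 (dL l) (j1 F) (j1 G) + pair2 L (j2 F l) (j1 G) + pair2 L (j1 F) (j2 G l))
  + (j1 F l * pair1 E (j1 G) + j0 F * (pair1 (dE l) (j1 G) + pair1 E (j2 G l)))
  - (j1 G l * pair1 E (j1 F) + j0 G * (pair1 (dE l) (j1 F) + pair1 E (j2 F l))).

Definition jet_bracket2 F G H : K :=
  (\sum_l (\sum_i L i l * j1 F i + j0 F * E l) * jet_dbracket G H l)
  - jet_bracket G H * pair1 E (j1 F).

Hypothesis Lskew : forall i j, L i j = - L j i.
Hypothesis jacobi_L : forall i j k,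
  \sum_l L l i * dL l j k + \sum_l L l j * dL l k i + \sum_l L l k * dL l i j
  = E i * L j k + E j * L k i + E k * L i j.
Hypothesis jacobi_E : forall i j,
  \sum_l (E l * dL l i j - L l j * dE l i - L i l * dE l j) = 0.

(** [ham F] is the vector L(dF, .), [A w] and [T w] are the derivatives of L and of E along w
    contracted with covectors, and [hess F] is the matrix of second derivatives of F as a bilinear
    form. *)
Let ham F l := \sum_i L i l * j1 F i.
Let A (w u v : 'I_d -> K) := \sum_l w l * pair2 (dL l) u v.
Let T (w u : 'I_d -> K) := \sum_l w l * pair1 (dE l) u.
Let hess F (u v : 'I_d -> K) := \sum_l \sum_i u l * v i * j2 F l i.

Let hessC F u v : (forall i j, j2 F i j = j2 F j i) -> hess F u v = hess F v u.
Proof.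
move=> sym; rewrite /hess exchange_big; apply: eq_bigr => i _.
by apply: eq_bigr => l _; rewrite sym [u l * _]mulrC.
Qed.

Let pair2C u v : pair2 L u v = - pair2 L v u.
Proof.
rewrite /pair2 exchange_big -sumrN; apply: eq_bigr => i _.
by rewrite -sumrN; apply: eq_bigr => j _; rewrite [L j i]Lskew !mulNr mulrAC.
Qed.

Let pair2_ham F u : pair2 L (j1 F) u = pair1 (ham F) u.
Proof.
rewrite /pair2 /pair1 exchange_big; apply: eq_bigr => i _.
by rewrite /ham mulr_suml.
Qed.

Let hess_pair1 F w u : \sum_l w l * pair1 u (j2 F l) = hess F w u.
Proof.
rewrite /pair1; apply: eq_bigr => l _; rewrite mulr_sumr.
by apply: eq_bigr => i _; rewrite mulrA.
Qed.

(* Only the Hessian terms [hess G w_F w_H] and [hess H w_F w_G], where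
   w_F = L(dF, .) + F E, survive; they cancel in the cyclic sum. *)
Let jet_bracket2E F G H (w := fun l => ham F l + j0 F * E l) :
  jet_bracket2 F G H =
    A w (j1 G) (j1 H) - hess G w (ham H) + hess H w (ham G)
    + pair1 w (j1 G) * pair1 E (j1 H) + j0 G * (T w (j1 H) + hess H w E)
    - pair1 w (j1 H) * pair1 E (j1 G) - j0 H * (T w (j1 G) + hess G w E)
    - jet_bracket G H * pair1 E (j1 F).
Proof.
rewrite /jet_bracket2 /jet_dbracket; congr (_ - _).
have pw u : pair1 w u = \sum_l w l * u l by [].
rewrite -!hess_pair1 !pw /A /T.
move: (pair1 E (j1 G)) (pair1 E (j1 H)) => eG eH.
rewrite !mulr_suml !mulrDr !opprD !mulr_sumr -!sumrN !addrA -!big_split/=; apply: eq_bigr => l _.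
by rewrite (pair2C (j2 G l)) !pair2_ham -/(ham F l) -/(w l); ring.
Qed.

Let a3 (f : 'I_d -> 'I_d -> 'I_d -> K) (u v w : 'I_d -> K) :=
  \sum_i \sum_j \sum_k f i j k * (u i * v j * w k).

Let eq_a3 f g u v w : (forall i j k, f i j k = g i j k) -> a3 f u v w = a3 g u v w.
Proof.
by move=> fg; do 3! (apply: eq_bigr => ? _); rewrite fg.
Qed.

Let a3D f g u v w : a3 (fun i j k => f i j k + g i j k) u v w = a3 f u v w + a3 g u v w.
Proof.
rewrite /a3 -big_split; apply: eq_bigr => i _; rewrite -big_split; apply: eq_bigr => j _.
by rewrite -big_split; apply: eq_bigr => k _; rewrite mulrDl.
Qed.

Let a3_rot f u v w : a3 (fun i j k => f j k i) u v w = a3 f v w u.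
Proof.
rewrite /a3 exchange_big; apply: eq_bigr => j _; rewrite exchange_big.
by apply: eq_bigr => k _; apply: eq_bigr => i _; congr (_ * _); ring.
Qed.

Let a3_wedge u v w : a3 (fun i j k => E i * L j k) u v w = pair1 E u * pair2 L v w.
Proof.
rewrite /a3 /pair1 /pair2 mulr_suml; apply: eq_bigr => i _; rewrite mulr_sumr.
apply: eq_bigr => j _; rewrite mulr_sumr; apply: eq_bigr => k _; ring.
Qed.

Let a3_schouten F u v :
  a3 (fun i j k => \sum_l L l i * dL l j k) (j1 F) u v = - A (ham F) u v.
Proof.
have -> : - A (ham F) u v =
    \sum_l \sum_i \sum_j \sum_k L l i * dL l j k * (j1 F i * u j * v k).
  rewrite /A /ham /pair2 -sumrN; apply: eq_bigr => l _; rewrite -mulNr -sumrN mulr_suml.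
  apply: eq_bigr => i _; rewrite mulr_sumr; apply: eq_bigr => j _.
  by rewrite mulr_sumr; apply: eq_bigr => k _; rewrite Lskew; ring.
rewrite [RHS]exchange_big; apply: eq_bigr => i _.
rewrite [RHS]exchange_big; apply: eq_bigr => j _.
by rewrite [RHS]exchange_big; apply: eq_bigr => k _; rewrite mulr_suml.
Qed.

(** The equation for [L, L] contracted with dF, dG, dH. Rotating the indices of the array is traded
    for rotating the covectors, and the sign comes from L l i = - L i l. *)
Let jacobi_A F G H :
  A (ham F) (j1 G) (j1 H) + A (ham G) (j1 H) (j1 F) + A (ham H) (j1 F) (j1 G) =
  - (pair1 E (j1 F) * pair2 L (j1 G) (j1 H) + pair1 E (j1 G) * pair2 L (j1 H) (j1 F)
     + pair1 E (j1 H) * pair2 L (j1 F) (j1 G)).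
Proof.
apply: oppr_inj; rewrite opprK !opprD -!a3_schouten -!a3_wedge.
rewrite -[X in _ + X + _]a3_rot -[X in _ + _ + X = _]a3_rot -[X in _ + _ + X = _]a3_rot.
rewrite -[X in _ = _ + X + _]a3_rot -[X in _ = _ + _ + X]a3_rot -[X in _ = _ + _ + X]a3_rot.
rewrite -!a3D; exact: eq_a3.
Qed.

(** The equation [E, L] = 0 contracted with dG and dH. *)
Let jacobi_AE G H : A E (j1 G) (j1 H) = T (ham G) (j1 H) - T (ham H) (j1 G).
Proof.
have exA : A E (j1 G) (j1 H) = \sum_i \sum_j \sum_l E l * dL l i j * (j1 G i * j1 H j).
  transitivity (\sum_l \sum_i \sum_j E l * dL l i j * (j1 G i * j1 H j)).
    rewrite /A /pair2; apply: eq_bigr => l _; rewrite mulr_sumr.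
    apply: eq_bigr => i _; rewrite mulr_sumr; apply: eq_bigr => j _; ring.
  by rewrite exchange_big; apply: eq_bigr => i _; rewrite exchange_big.
have exG : T (ham G) (j1 H) = \sum_i \sum_j \sum_l L i l * dE l j * (j1 G i * j1 H j).
  transitivity (\sum_l \sum_i \sum_j L i l * dE l j * (j1 G i * j1 H j)).
    rewrite /T /ham /pair1; apply: eq_bigr => l _; rewrite mulr_suml.
    apply: eq_bigr => i _; rewrite mulr_sumr; apply: eq_bigr => j _; ring.
  by rewrite exchange_big; apply: eq_bigr => i _; rewrite exchange_big.
have exH : - T (ham H) (j1 G) = \sum_i \sum_j \sum_l L l j * dE l i * (j1 G i * j1 H j).
  transitivity (\sum_l \sum_j \sum_i L l j * dE l i * (j1 G i * j1 H j)).
    rewrite /T /ham /pair1 -sumrN; apply: eq_bigr => l _; rewrite -mulNr -sumrN mulr_suml.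
    apply: eq_bigr => j _; rewrite mulr_sumr; apply: eq_bigr => i _.
    by rewrite [L j l]Lskew; ring.
  under eq_bigr do rewrite exchange_big.
  by rewrite exchange_big; apply: eq_bigr => i _; rewrite exchange_big.
rewrite exA exG exH -big_split; apply: eq_bigr => i _; rewrite -big_split.
apply: eq_bigr => j _; rewrite -big_split/=; apply/eqP; rewrite -subr_eq0 -sumrB.
apply/eqP; transitivity
  ((\sum_l (E l * dL l i j - L l j * dE l i - L i l * dE l j)) * (j1 G i * j1 H j)).
  by rewrite mulr_suml; apply: eq_bigr => l _; ring.
by rewrite jacobi_E mul0r.
Qed.

Let splitA F u v : A (fun l => ham F l + j0 F * E l) u v = A (ham F) u v + j0 F * A E u v.
Proof.
rewrite /A /T mulr_sumr -big_split/=; apply: eq_bigr => l _.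
by rewrite mulrDl mulrA.
Qed.

Let splitT F u : T (fun l => ham F l + j0 F * E l) u = T (ham F) u + j0 F * T E u.
Proof.
rewrite /A /T mulr_sumr -big_split/=; apply: eq_bigr => l _.
by rewrite mulrDl mulrA.
Qed.

Let split1 F u : pair1 (fun l => ham F l + j0 F * E l) u = pair2 L (j1 F) u + j0 F * pair1 E u.
Proof.
rewrite pair2_ham /pair1 mulr_sumr -big_split; apply: eq_bigr => l _.
by rewrite mulrDl mulrA.
Qed.

Let split_hess H F u :
  hess H (fun l => ham F l + j0 F * E l) u = hess H (ham F) u + j0 F * hess H E u.
Proof.
rewrite /hess mulr_sumr -big_split; apply: eq_bigr => l _.
rewrite mulr_sumr -big_split/=; apply: eq_bigr => i _; ring.
Qed.

Lemma jet_jacobi F G H :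
  (forall i j, j2 F i j = j2 F j i) -> (forall i j, j2 G i j = j2 G j i) ->
  (forall i j, j2 H i j = j2 H j i) ->
  jet_bracket2 F G H + jet_bracket2 G H F + jet_bracket2 H F G = 0.
Proof.
move=> sF sG sH; have JA := jacobi_A F G H.
rewrite !jet_bracket2E !splitA !splitT !split1 !split_hess !jacobi_AE /jet_bracket.
(* One orientation is fixed for each symmetric Hessian term and each skew pairing, so that matching
   terms become syntactically equal for [ring]. *)
rewrite (hessC (ham G) (ham F) sH) (hessC (ham H) (ham G) sF) (hessC (ham F) (ham H) sG).
rewrite !(hessC E (ham _) sF) !(hessC E (ham _) sG) !(hessC E (ham _) sH).
rewrite (pair2C (j1 F) (j1 G)) (pair2C (j1 G) (j1 H)) (pair2C (j1 H) (j1 F)).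
rewrite (pair2C (j1 F) (j1 G)) (pair2C (j1 G) (j1 H)) (pair2C (j1 H) (j1 F)) in JA.
(* Solving [JA] for one of its three terms builds the equation for [L, L] into the goal. *)
have -> : A (ham F) (j1 G) (j1 H) =
   - (A (ham G) (j1 H) (j1 F) + A (ham H) (j1 F) (j1 G))
   - (pair1 E (j1 F) * - pair2 L (j1 H) (j1 G) + pair1 E (j1 G) * - pair2 L (j1 F) (j1 H)
     + pair1 E (j1 H) * - pair2 L (j1 G) (j1 F)).
  by rewrite -JA; ring.
ring.
Qed.

End JetJacobi.

(** * Vector and bivector fields in charts *)

Lemma is_derive_fsum (R : realType) (V : normedModType R) (n : nat)
    (h : 'I_n -> V -> R) (dh : 'I_n -> R) (x v : V) :
  (forall i, is_derive x v (h i) (dh i)) ->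
  is_derive x v (fun y => \sum_i h i y) (\sum_i dh i).
Proof.
move=> Dh; have -> : (fun y => \sum_i h i y) = \sum_i h i.
  by apply/funext => y; rewrite fct_sumE.
exact: is_derive_sum.
Qed.

Lemma is_derive_fmul (R : realType) (V : normedModType R)
    (f g : V -> R) (df dg : R) (x v : V) :
  is_derive x v f df -> is_derive x v g dg ->
  is_derive x v (fun y => f y * g y) (df * g x + f x * dg).
Proof.
move=> Df Dg; apply: is_derive_eq (is_deriveM Df Dg) _.
by rewrite /GRing.scale/= addrC [g x * _]mulrC.
Qed.

Section Atlas.
Context {R : realType} {d : nat} {N : Type} {At : atlas R d N}.
Implicit Types (c : chart At) (p : N) (F G H : N -> R).

Lemma co_image c p : cdom c p -> (co c @` cdom c) (co c p).
Proof. by exists p. Qed.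

Lemma co_image_openT c : open (co c @` cdom c).
Proof. by have := @co_open _ _ _ At c c; rewrite setIid. Qed.

Lemma near_co_image c p : cdom c p -> \forall y \near co c p, (co c @` cdom c) y.
Proof.
by move=> cp; apply: open_nbhs_nbhs; split; [exact: co_image_openT|exact: co_image].
Qed.

Lemma smooth_funP F :
  smooth_fun At F <-> forall c, smooth_on (co c @` cdom c) (F \o pt c).
Proof. by split=> sF c; have := sF c; rewrite setIT. Qed.

Lemma near_eq_dpartial c i F G p :
  (\forall y \near co c p, F (pt c y) = G (pt c y)) ->
  dpartial c i F p = dpartial c i G p.
Proof. by move=> FG; exact: near_eq_derive. Qed.

Lemma smooth_fun_cst (a : R) : smooth_fun At (fun=> a).
Proof. by move=> c; exact: smooth_on_cst. Qed.

Lemma smooth_funD F G : smooth_fun At F -> smooth_fun At G ->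
  smooth_fun At (fun p => F p + G p).
Proof.
move=> /smooth_funP sF /smooth_funP sG; apply/smooth_funP => c.
exact: (smooth_onD (@co_image_openT c) (sF c) (sG c)).
Qed.

Lemma smooth_funM F G : smooth_fun At F -> smooth_fun At G ->
  smooth_fun At (fun p => F p * G p).
Proof.
move=> /smooth_funP sF /smooth_funP sG; apply/smooth_funP => c.
exact: (smooth_onM (@co_image_openT c) (sF c) (sG c)).
Qed.

Lemma is_derive_dpartial c i F p : smooth_fun At F -> cdom c p ->
  is_derive (co c p) (delta_mx 0 i) (F \o pt c) (dpartial c i F p).
Proof.
move=> /smooth_funP sF cp; apply: derivableP.
by have [_ + _] := smooth_onP (sF c); apply; exact: co_image.
Qed.

Lemma dpartial_cst c i (a : R) p : dpartial c i (fun=> a) p = 0.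
Proof. exact: derive_cst. Qed.

Lemma dpartialD c i F G p : smooth_fun At F -> smooth_fun At G -> cdom c p ->
  dpartial c i (fun q => F q + G q) p = dpartial c i F p + dpartial c i G p.
Proof.
move=> sF sG cp; have DF := is_derive_dpartial i sF cp.
have DG := is_derive_dpartial i sG cp.
exact: (@derive_val _ _ _ _ _ _ _ (is_deriveD DF DG)).
Qed.

Lemma dpartialM c i F G p : smooth_fun At F -> smooth_fun At G -> cdom c p ->
  dpartial c i (fun q => F q * G q) p = dpartial c i F p * G p + F p * dpartial c i G p.
Proof.
move=> sF sG cp; have DF := is_derive_dpartial i sF cp.
have DG := is_derive_dpartial i sG cp.
by have := @derive_val _ _ _ _ _ _ _ (is_derive_fmul DF DG); rewrite /= coK.
Qed.

Definition dgrad c F p : 'cV[R]_d := \col_i dpartial c i F p.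

Lemma dgrad_change c c' F p : smooth_fun At F -> cdom c p -> cdom c' p ->
  dgrad c F p = Defs.jacobian c c' p *m dgrad c' F p.
Proof.
move=> /smooth_funP sF cp c'p; apply/colP => i; rewrite !mxE.
have overlap : (co c @` (cdom c `&` cdom c')) (co c p) by exists p.
have -> : dpartial c i F p = partial i (fun y => (F \o pt c') (co c' (pt c y))) (co c p).
  apply: near_eq_derive.
  have : \forall y \near co c p, (co c @` (cdom c `&` cdom c')) y.
    by apply: open_nbhs_nbhs; split => //; exact: co_open.
  by apply: filterS => _ [q [cq c'q] <-] /=; rewrite !coK.
have dF : differentiable (F \o pt c') (co c' (pt c (co c p))).
  by rewrite coK//; apply: (smooth_differentiable (@co_image_openT c') (sF c')); exact: co_image.
have dco l : derivable (fun y => co c' (pt c y) 0 l) (co c p) (delta_mx 0 i).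
  by have [_ + _] := smooth_onP (@co_smooth _ _ _ At c c' l); apply.
have D := is_derive_comp_rV dco dF.
rewrite /partial (@derive_val _ _ _ _ _ _ _ D); apply: eq_bigr => l _.
by rewrite !mxE coK.
Qed.

(** [vf_apply] is computed in the preferred chart. The components of a vector and of a differential
    change by mutually compensating factors of the Jacobian matrix, so every chart around p gives
    the same value. *)
Lemma vf_applyE (X : forall p, tangent At p) F c p : smooth_fun At F -> cdom c p ->
  vf_apply (fun q (c : chart At) => X q c) F p = \sum_i X p c 0 i * dpartial c i F p.
Proof.
move=> sF cp; have c0p := chart_atP At p.
transitivity ((X p (chart_at At p) *m dgrad (chart_at At p) F p) 0 0).
  by rewrite mxE; apply: eq_bigr => i _; rewrite mxE.
rewrite (dgrad_change sF c0p cp) mulmxA -(tcomp_change (X p) c0p cp) mxE.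
by apply: eq_bigr => i _; rewrite mxE.
Qed.

Lemma bf_applyE (P : forall p, bivector At p) F G c p :
  smooth_fun At F -> smooth_fun At G -> cdom c p ->
  bf_apply (fun q (c : chart At) => P q c) F G p =
  \sum_i \sum_j P p c i j * dpartial c i F p * dpartial c j G p.
Proof.
move=> sF sG cp; have c0p := chart_atP At p.
have mxsum c' : \sum_i \sum_j P p c' i j * dpartial c' i F p * dpartial c' j G p =
    (((dgrad c' F p)^T *m P p c') *m dgrad c' G p) 0 0.
  rewrite mxE exchange_big; apply: eq_bigr => j _; rewrite !mxE mulr_suml.
  by apply: eq_bigr => i _; rewrite !mxE [_ * P p c' i j]mulrC.
rewrite /bf_apply !mxsum (dgrad_change sF c0p cp) (dgrad_change sG c0p cp).
by rewrite trmx_mul (bcomp_change (P p) c0p cp) !mulmxA.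
Qed.

Lemma smooth_dpartial c i F : smooth_fun At F ->
  smooth_on (co c @` cdom c) (fun y => dpartial c i F (pt c y)).
Proof.
move=> /smooth_funP sF; have [_ _ s1F] := smooth_onP (sF c).
apply: eq_smooth_on (s1F i); first exact: co_image_openT.
by move=> _ [p cp <-]; rewrite /dpartial coK.
Qed.

Lemma smooth_vf_apply (X : vector_field At) F : smooth_fun At F ->
  smooth_fun At (vf_apply (comp1 X) F).
Proof.
move=> sF; apply/smooth_funP => c; have oU := @co_image_openT c.
apply: (@eq_smooth_on _ _ _
  (fun y => \sum_i X (pt c y) c 0 i * dpartial c i F (pt c y))) => //.
  by move=> _ [p cp <-] /=; rewrite coK// (@vf_applyE X F c p).
apply: smooth_on_sum => // i; apply: smooth_onM => //; last exact: smooth_dpartial.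
by have := vf_smooth X c i c; rewrite setIid.
Qed.

Lemma smooth_bf_apply (P : bivector_field At) F G :
  smooth_fun At F -> smooth_fun At G -> smooth_fun At (bf_apply (comp2 P) F G).
Proof.
move=> sF sG; apply/smooth_funP => c; have oU := @co_image_openT c.
apply: (@eq_smooth_on _ _ _ (fun y => \sum_i \sum_j
  P (pt c y) c i j * dpartial c i F (pt c y) * dpartial c j G (pt c y))) => //.
  by move=> _ [p cp <-] /=; rewrite coK// (@bf_applyE P F G c p).
apply: smooth_on_sum => // i; apply: smooth_on_sum => // j.
apply: smooth_onM => //; last exact: smooth_dpartial.
apply: smooth_onM => //; last exact: smooth_dpartial.
by have := bf_smooth P c i j c; rewrite setIid.
Qed.

Lemma vf_apply_cst (X : field1 At) (a : R) p : vf_apply X (fun=> a) p = 0.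
Proof. by rewrite /vf_apply big1// => i _; rewrite dpartial_cst mulr0. Qed.

Lemma vf_applyM (X : field1 At) F G p : smooth_fun At F -> smooth_fun At G ->
  vf_apply X (fun q => F q * G q) p = F p * vf_apply X G p + G p * vf_apply X F p.
Proof.
move=> sF sG; rewrite /vf_apply !mulr_sumr -big_split/=; apply: eq_bigr => i _.
by rewrite dpartialM//; [ring|exact: chart_atP].
Qed.

Lemma vf_applyD (X : field1 At) F G p : smooth_fun At F -> smooth_fun At G ->
  vf_apply X (fun q => F q + G q) p = vf_apply X F p + vf_apply X G p.
Proof.
move=> sF sG; rewrite /vf_apply -big_split/=; apply: eq_bigr => i _.
by rewrite dpartialD//; [rewrite mulrDr|exact: chart_atP].
Qed.

Lemma bf_apply_cst (P : field2 At) F (a : R) p : bf_apply P F (fun=> a) p = 0.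
Proof.
by rewrite /bf_apply big1// => i _; rewrite big1// => j _; rewrite dpartial_cst mulr0.
Qed.

Lemma bf_applyM (P : field2 At) F G H p : smooth_fun At G -> smooth_fun At H ->
  bf_apply P F (fun q => G q * H q) p = G p * bf_apply P F H p + H p * bf_apply P F G p.
Proof.
move=> sG sH; rewrite /bf_apply !mulr_sumr -big_split/=; apply: eq_bigr => i _.
rewrite !mulr_sumr -big_split/=; apply: eq_bigr => j _.
by rewrite dpartialM//; [ring|exact: chart_atP].
Qed.

Lemma bf_applyD (P : field2 At) F G H p : smooth_fun At G -> smooth_fun At H ->
  bf_apply P F (fun q => G q + H q) p = bf_apply P F G p + bf_apply P F H p.
Proof.
move=> sG sH; rewrite /bf_apply -big_split/=; apply: eq_bigr => i _.
rewrite -big_split/=; apply: eq_bigr => j _.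
by rewrite dpartialD//; [ring|exact: chart_atP].
Qed.

Lemma bcomp_anti p (b : bivector At p) c i j : cdom c p -> b c i j = - b c j i.
Proof. by move=> cp; have /matrixP/(_ j i) := bcomp_skew b cp; rewrite !mxE. Qed.

Lemma bf_applyC (P : bivector_field At) F G p :
  bf_apply (comp2 P) F G p = - bf_apply (comp2 P) G F p.
Proof.
rewrite /bf_apply exchange_big -sumrN; apply: eq_bigr => i _; rewrite -sumrN.
by apply: eq_bigr => j _; rewrite /comp2 bcomp_anti; [ring|exact: chart_atP].
Qed.

(** * The Jacobi bracket of functions *)

Section JacobiBracket.
Variables (L : bivector_field At) (E : vector_field At).
Local Notation "{[ F , G ]}" := (jacobi_bracket L E F G).

Lemma smooth_jacobi_bracket F G : smooth_fun At F -> smooth_fun At G ->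
  smooth_fun At {[F, G]}.
Proof.
move=> sF sG; have -> : {[F, G]} = fun p => bf_apply (comp2 L) F G p
    + F p * vf_apply (comp1 E) G p + -1 * (G p * vf_apply (comp1 E) F p).
  by apply/funext => p; rewrite mulN1r.
have sEF := smooth_vf_apply E sF; have sEG := smooth_vf_apply E sG.
apply: smooth_funD; first apply: smooth_funD.
- exact: smooth_bf_apply.
- exact: smooth_funM.
- by apply: smooth_funM; [exact: smooth_fun_cst|exact: smooth_funM].
Qed.

Lemma jacobi_bracketC F G p : {[F, G]} p = - {[G, F]} p.
Proof. by rewrite /jacobi_bracket bf_applyC; ring. Qed.

Lemma jacobi_bracketD F G H p : smooth_fun At G -> smooth_fun At H ->
  {[F, fun q => G q + H q]} p = {[F, G]} p + {[F, H]} p.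
Proof. by move=> sG sH; rewrite /jacobi_bracket bf_applyD// vf_applyD//; ring. Qed.

(** The bracket is a first-order differential operator in its second argument, not a derivation: the
    last factor is {F, G} - G {F, 1}. *)
Lemma jacobi_bracketM F G H p : smooth_fun At G -> smooth_fun At H ->
  {[F, fun q => G q * H q]} p = G p * {[F, H]} p
    + H p * (bf_apply (comp2 L) F G p + F p * vf_apply (comp1 E) G p).
Proof. by move=> sG sH; rewrite /jacobi_bracket bf_applyM// vf_applyM//; ring. Qed.

Lemma jacobi_bracket1 F p : {[F, fun=> 1]} p = - vf_apply (comp1 E) F p.
Proof. by rewrite /jacobi_bracket bf_apply_cst vf_apply_cst; ring. Qed.

Definition fun_jet c F p : @jet R d :=
  Jet (F p) (fun i => dpartial c i F p)
      (fun l i => partial l (partial i (F \o pt c)) (co c p)).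

Lemma jacobi_bracketE F G c p : smooth_fun At F -> smooth_fun At G -> cdom c p ->
  {[F, G]} p = jet_bracket (L p c) (E p c 0) (fun_jet c F p) (fun_jet c G p).
Proof.
move=> sF sG cp; rewrite /jacobi_bracket (@bf_applyE L F G c)//.
by rewrite (@vf_applyE E F c)// (@vf_applyE E G c).
Qed.

Lemma dpartial_jacobi_bracket F G c l p :
  smooth_fun At F -> smooth_fun At G -> cdom c p ->
  dpartial c l {[F, G]} p =
    jet_dbracket (L p c) (fun l i j => dpartial c l (fun q => L q c i j) p)
      (E p c 0) (fun l i => dpartial c l (fun q => E q c 0 i) p)
      (fun_jet c F p) (fun_jet c G p) l.
Proof.
move=> sF sG cp; pose v : 'rV[R]_d := delta_mx 0 l; pose x := co c p.
have Ux := co_image cp.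
pose FF y := F (pt c y); pose GG y := G (pt c y).
pose LL i j y := L (pt c y) c i j; pose EE i y := E (pt c y) c 0 i.
have DL i j : is_derive x v (LL i j) (dpartial c l (fun q => L q c i j) p).
  apply: derivableP; have := bf_smooth L c i j c; rewrite setIid.
  by move=> /smooth_onP[_ + _]; apply.
have DE i : is_derive x v (EE i) (dpartial c l (fun q => E q c 0 i) p).
  apply: derivableP; have := vf_smooth E c i c; rewrite setIid.
  by move=> /smooth_onP[_ + _]; apply.
have D2 f i : smooth_fun At f -> is_derive x v (partial i (f \o pt c))
    (partial l (partial i (f \o pt c)) x).
  move=> /smooth_funP sf; apply: derivableP.
  have [_ _ s1f] := smooth_onP (sf c).
  by have [_ + _] := smooth_onP (s1f i); apply.
have DF := is_derive_dpartial l sF cp; have DG := is_derive_dpartial l sG cp.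
have Dvf (g : N -> R) (sg : smooth_fun At g) :=
  is_derive_fsum (fun i => is_derive_fmul (DE i) (D2 g i sg)).
have Dbf := is_derive_fsum (fun i => is_derive_fsum (fun j =>
  is_derive_fmul (is_derive_fmul (DL i j) (D2 F i sF)) (D2 G j sG))).
have D := is_deriveB (is_deriveD Dbf (is_derive_fmul DF (Dvf G sG)))
            (is_derive_fmul DG (Dvf F sF)).
have eD : \forall y \near x, ({[F, G]} \o pt c) y = (((fun y => \sum_i \sum_j
      LL i j y * partial i (F \o pt c) y * partial j (G \o pt c) y)
      + (fun y => (F \o pt c) y * \sum_i EE i y * partial i (G \o pt c) y))
      - (fun y => (G \o pt c) y * \sum_i EE i y * partial i (F \o pt c) y)) y.
  apply: filterS (near_co_image cp) => _ [q cq <-] /=.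
  rewrite coK// (jacobi_bracketE sF sG cq) /jet_bracket /pair2 /pair1 /=.
  by rewrite /LL /EE /dpartial !fctE /= coK.
rewrite /dpartial /partial (near_eq_derive _ eD) (@derive_val _ _ _ _ _ _ _ D).
rewrite /jet_dbracket /pair2 /pair1/= /LL /EE /x /= coK//.
congr (_ + _ - _).
- rewrite -!big_split/=; apply: eq_bigr => i _; rewrite -!big_split/=.
  by apply: eq_bigr => j _; rewrite mulrDl.
- by congr (_ * _ + _ * _); rewrite -big_split.
- by congr (_ * _ + _ * _); rewrite -big_split.
Qed.

Hypothesis LE : jacobi_structure L E.

(** In one chart around p the iterated bracket is a function of the 2-jets of F, G, H at p, which
    reduces the claim to [jet_jacobi]; the Hessians are symmetric by Schwarz. *)
Lemma jacobi_bracket_jacobi F G H p :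
  smooth_fun At F -> smooth_fun At G -> smooth_fun At H ->
  {[F, {[G, H]}]} p + {[G, {[H, F]}]} p + {[H, {[F, G]}]} p = 0.
Proof.
move=> sF sG sH; pose c := chart_at At p; have cp : cdom c p := chart_atP At p.
pose dL l i j := dpartial c l (fun q => L q c i j) p.
pose dE l i := dpartial c l (fun q => E q c 0 i) p.
have iter f g h : smooth_fun At f -> smooth_fun At g -> smooth_fun At h ->
    {[f, {[g, h]}]} p = jet_bracket2 (L p c) dL (E p c 0) dE
      (fun_jet c f p) (fun_jet c g p) (fun_jet c h p).
  move=> sf sg sh; have sgh := smooth_jacobi_bracket sg sh.
  rewrite (jacobi_bracketE sf sgh cp) /jet_bracket /jet_bracket2 /=.
  rewrite (jacobi_bracketE sg sh cp); congr (_ - _).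
  rewrite /pair2 exchange_big /pair1 mulr_sumr -big_split/=; apply: eq_bigr => l _.
  by rewrite (dpartial_jacobi_bracket _ sg sh cp) mulrDl mulr_suml mulrA.
have sym f : smooth_fun At f -> forall i j, j2 (fun_jet c f p) i j = j2 (fun_jet c f p) j i.
  move=> /smooth_funP sf i j.
  exact: (partialC _ _ (@co_image_openT c) (sf c) (co_image cp)).
rewrite !iter//; apply: jet_jacobi; try exact: sym.
- by move=> i j; exact: bcomp_anti.
- move=> i j k; have := LE.1 p c cp i j k; rewrite /schouten22 /wedge12.
  (* Bracketing L with itself doubles each term of [schouten22], which cancels the 2 in front of E
     /\ L. *)
  have dbl (f g : 'I_d -> R) : \sum_l (f l * g l + f l * g l) = 2 * \sum_l f l * g l.
    by rewrite mulr_sumr; apply: eq_bigr => l _; ring.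
  rewrite !dbl -!mulrDr => /mulfI; apply.
  by rewrite pnatr_eq0.
- by move=> i j; have /matrixP/(_ i j) := LE.2 p c cp; rewrite !mxE.
Qed.

End JacobiBracket.
End Atlas.

(** * Global extension of coordinates and frames *)

Section Manifold.
Context {R : realType} {m : nat} {M : manifold R m}.
Implicit Types (c : chart M) (x : M) (f g : M -> R) (V W K : set M).

Lemma near_pt c x (P : M -> Prop) : cdom c x -> (\forall z \near x, P z) ->
  \forall y \near co c x, P (pt c y).
Proof. by move=> cx Px; apply: (pt_continuous (co_image cx)); rewrite coK. Qed.

Lemma smooth_fun_on_near V f :
  (forall x, V x -> exists2 g, smooth_fun M g & \forall z \near x, g z = f z) ->
  smooth_fun_on M V f.
Proof.
move=> loc c; apply: smooth_on_local => _ [x [cx /loc[g sg gf]] <-].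
have /smooth_funP/(_ c) sgc := sg.
exists (co c @` cdom c), (g \o pt c); split; [exact: co_image|exact: sgc|].
exact: near_pt gf.
Qed.

(** Extension by zero: at a point of W smoothness is assumed, and a point outside W has the
    complement of the closed set K as a neighbourhood on which g vanishes. *)
Lemma smooth_fun_on_extend K W V g : closed K -> K `<=` W ->
  smooth_fun_on M (W `&` V) g -> (forall x, ~ K x -> g x = 0) -> smooth_fun_on M V g.
Proof.
move=> cK KW sg g0 c; apply: smooth_on_local => _ [x [cx Vx] <-].
have [Wx|nWx] := pselect (W x).
  exists (co c @` (cdom c `&` (W `&` V))), (g \o pt c); split.
  - by exists x.
  - exact: sg.
  - by apply: (@filterE _ (nbhs (co c x))) => y.
exists setT, (fun=> 0); split=> //; first exact: smooth_on_cst.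
have oK : open (~` K) by exact: closed_openC.
have : \forall z \near x, 0 = g z.
  have : \forall z \near x, (~` K) z.
    by apply: open_nbhs_nbhs; split=> // /KW.
  by apply: filterS => z /g0.
exact: near_pt.
Qed.

(** The closed set K is returned with chi so that the product of chi with a function defined only on
    W can be extended by zero. *)
Lemma bump W x : open W -> W x -> exists chi K,
  [/\ closed K, K `<=` W, smooth_fun M chi, forall z, ~ K z -> chi z = 0 &
      \forall z \near x, chi z = 1].
Proof.
move=> oW Wx; pose c := chart_at M x; have cx : cdom c x := chart_atP M x.
pose u := co c x; pose W' := cdom c `&` W.
have oW' : open W' by apply: openI => //; exact: cdom_open.
have /nbhs_ballP[r /= r0 rO] : nbhs u (co c @` W').
  by apply: open_nbhs_nbhs; split; [exact: co_image_open|exists x].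
(* Half the radius keeps the closed box B of half-side e inside the open ball. *)
pose e := r / 2; have e0 : 0 < e by rewrite divr_gt0.
pose B := [set y : 'rV[R]_m | forall l, `[u 0 l - e, u 0 l + e]%classic (y 0 l)].
have inB (y : 'rV[R]_m) : (forall l, `|y 0 l - u 0 l| <= e) <-> B y.
  by split=> By l; have := By l; rewrite ler_distl /= in_itv.
have BO : B `<=` co c @` W'.
  move=> y /inB By; apply: rO; rewrite -ball_normE /ball_/=.
  apply: (@le_lt_trans _ _ e); last by rewrite /e; lra.
  by apply: rV_norm_le => [|l]; [exact: ltW|rewrite !mxE distrC].
pose K := pt c @` B.
(* Compactness of the box passes to its image in M, which is closed because M is Hausdorff. *)
have closedK : closed K.
  apply: compact_closed; first exact: mfd_hausdorff.
  apply: continuous_compact.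
    apply: continuous_in_subspaceT => y; rewrite inE => /BO[z [cz _] <-].
    exact: (pt_continuous (co_image cz)).
  by apply: (@rV_compact _ _ (fun l => `[u 0 l - e, u 0 l + e]%classic)) => l;
    exact: segment_compact.
have KW' : K `<=` W' by move=> _ [y /BO[z [cz Wz] <-] <-]; rewrite coK.
pose sq (y : 'rV[R]_m) := \sum_l (y 0 l - u 0 l) * (y 0 l - u 0 l).
(* Outside the box one coordinate differs by more than e, so sq > 2a and the argument of [plateau]
   is negative; close to x, sq < a and the argument exceeds 1. *)
pose a := e * e / 2; have a0 : 0 < a by rewrite divr_gt0// mulr_gt0.
pose chi z := if `[< W' z >] then plateau (2 - a^-1 * sq (co c z)) else 0.
have chi0 z : ~ K z -> chi z = 0.
  rewrite /chi; case: asboolP => // -[cz Wz] nKz; apply: plateau_le0.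
  rewrite subr_le0 mulrC ler_pdivlMr//.
  have [l el] : exists l, e < `|co c z 0 l - u 0 l|.
    apply/not_existsP => small; apply: nKz; exists (co c z); last by rewrite coK.
    by apply/inB => l; rewrite leNgt; apply/negP/small.
  rewrite /sq (bigD1 l)//= (_ : 2 * a = e * e); last by rewrite /a; lra.
  rewrite ler_wpDr ?sumr_ge0// => [i _|]; first by rewrite -expr2 sqr_ge0.
  by rewrite -[leRHS]ger0_norm -?expr2 ?sqr_ge0// normrX !expr2 ler_pM ?(ltW e0)// ltW.
have smooth_sq (V : set 'rV[R]_m) (h : 'I_m -> 'rV[R]_m -> R) : open V -> (forall l, smooth_on V (h l)) ->
    smooth_on V (fun y => \sum_l (h l y - u 0 l) * (h l y - u 0 l)).
  move=> oV sh; apply: smooth_on_sum => // l.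
  by apply: smooth_onM => //; apply: smooth_onB => //; exact: smooth_on_cst.
exists chi, K; split=> //; first by move=> z /KW'[].
  apply: (smooth_fun_on_extend closedK KW' _ chi0) => c'; rewrite setIT.
  have oV := co_image_open (c := c') oW'.
  apply: (@eq_smooth_on _ _ _
    (fun y => plateau (2 - a^-1 * sq (co c (pt c' y))))) => //.
    by move=> _ [z [c'z Wz] <-] /=; rewrite /chi coK//; case: asboolP.
  apply: smooth_plateau => //; apply: smooth_onB => //; first exact: smooth_on_cst.
  apply: smooth_onM => //; first exact: smooth_on_cst.
  apply: (smooth_sq _ (fun l y => co c (pt c' y) 0 l)) => // l.
  by apply: smooth_on_sub (@co_smooth _ _ _ M c' c l) => _ [z [c'z [cz _]] <-]; exists z.
have sq_small : \forall y \near u, sq y < a.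
  have csq : {for u, continuous sq}.
    apply: (smooth_sq setT (fun l y => y 0 l) openT _ 0%N u) => // l.
    exact: smooth_on_coord.
  have squ : sq u = 0 by rewrite /sq big1// => l _; rewrite subrr mulr0.
  have /cvgrPdist_lt/(_ _ a0) := csq; rewrite squ; apply: filterS => y.
  by rewrite sub0r normrN; exact/le_lt_trans/ler_norm.
have near_x : \forall z \near x, W' z by apply: open_nbhs_nbhs.
have near_sq : \forall z \near x, sq (co c z) < a by exact: (co_continuous cx sq_small).
near=> z; have W'z : W' z by near: z.
rewrite /chi; case: asboolP => // _; apply: plateau_ge1.
have sqz : a^-1 * sq (co c z) <= 1.
  by rewrite mulrC ler_pdivrMr// mul1r ltW//; near: z.
lra.
Unshelve. all: by end_near. Qed.

Lemma extend_coord c x l : cdom c x -> exists2 f, smooth_fun M f &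
  \forall z \near x, f z = co c z 0 l.
Proof.
move=> cx; have [chi [K [cK KW schi chi0 chi1]]] := bump (cdom_open c) cx.
exists (fun z => chi z * co c z 0 l).
  apply: (smooth_fun_on_extend cK KW) => [c'|z /chi0 ->]; last by rewrite mul0r.
  rewrite setIT; apply: smooth_onM; first exact: (co_image_open (cdom_open c)).
    by apply: smooth_on_sub (schi c') => _ [z [c'z _] <-]; exists z.
  exact: co_smooth.
by apply: filterS chi1 => z ->; rewrite mul1r.
Qed.

Context {n : nat} (A : vector_bundle M n).

Lemma extend_frame (j : triv A) x i : vdom j x -> exists s, smooth_section s /\
  \forall z \near x, s z = frame j z i.
Proof.
move=> jx; have [chi [K [cK KW schi chi0 chi1]]] := bump (vdom_open j) jx.
exists (fun z => chi z *: frame j z i); split; last first.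
  by apply: filterS chi1 => z ->; rewrite scale1r.
move=> k l; apply: (smooth_fun_on_extend cK KW) => [c|z /chi0 ->]; last first.
  by rewrite scale0r linear0 mxE.
apply: (@eq_smooth_on _ _ _ (fun y => chi (pt c y) * coord k (pt c y) (frame j (pt c y) i) 0 l)).
- by apply: co_image_open; apply: openI; exact: vdom_open.
- by move=> y _ /=; rewrite linearZ mxE.
apply: smooth_onM.
- by apply: co_image_open; apply: openI; exact: vdom_open.
- by apply: smooth_on_sub (schi c) => _ [z [cz _] <-]; exists z.
exact: coord_smooth.
Qed.

End Manifold.

(** * Functions on the dual bundle *)

Lemma punctured_const (R : realType) (k : R -> R) (v : R) :
  {for 0, continuous k} -> (forall t, t != 0 -> k t = v) -> k 0 = v.
Proof.
move=> ck kv; apply/eqP; rewrite -subr_eq0 -normr_le0; apply/ler_addgt0Pl => e e0.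
rewrite addr0; have /cvgrPdist_le/(_ e e0)/nbhs_ballP[r /= r0 kr] := ck.
have r2 : 0 < r / 2 by rewrite divr_gt0.
rewrite -(kv (r / 2)) ?gt_eqF//; apply: kr.
by rewrite -ball_normE /ball_/= sub0r normrN gtr0_norm//; lra.
Qed.

(** * Base and fibre coordinates *)

Section SplitCoordinates.
Context {R : realType} {m n : nat}.
Implicit Types (y v : 'rV[R]_(m + n)).

Lemma lsubmx_line (t : R) v y : lsubmx (t *: v + y) = t *: lsubmx v + lsubmx y.
Proof. by apply/rowP => i; rewrite !mxE. Qed.

Lemma rsubmx_line (t : R) v y : rsubmx (t *: v + y) = t *: rsubmx v + rsubmx y.
Proof. by apply/rowP => i; rewrite !mxE. Qed.

Lemma lsubmx_d_x l : lsubmx (delta_mx 0 (lshift n l) : 'rV[R]_(m + n)) = delta_mx 0 l.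
Proof. by apply/rowP => j; rewrite !mxE (inj_eq (@lshift_inj _ _)). Qed.

Lemma rsubmx_d_x l : rsubmx (delta_mx 0 (lshift n l) : 'rV[R]_(m + n)) = 0.
Proof. by apply/rowP => j; rewrite !mxE eq_rlshift andbF. Qed.

Lemma lsubmx_d_mu i : lsubmx (delta_mx 0 (rshift m i) : 'rV[R]_(m + n)) = 0.
Proof. by apply/rowP => j; rewrite !mxE eq_lrshift andbF. Qed.

Lemma rsubmx_d_mu i : rsubmx (delta_mx 0 (rshift m i) : 'rV[R]_(m + n)) = delta_mx 0 i.
Proof. by apply/rowP => j; rewrite !mxE (inj_eq (@rshift_inj _ _)). Qed.

Lemma partial_lsubmx_l l (g : 'rV[R]_m -> R) y :
  partial (lshift n l) (fun y => g (lsubmx y)) y = partial l g (lsubmx y).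
Proof.
have e : (fun t : R => g (lsubmx (t *: delta_mx 0 (lshift n l) + y))) =
         (fun t : R => g (t *: delta_mx 0 l + lsubmx y)).
  by apply/funext => t; rewrite lsubmx_line lsubmx_d_x.
by rewrite /partial [LHS]derive_line e -derive_line.
Qed.

Lemma partial_lsubmx_r i (g : 'rV[R]_m -> R) y :
  partial (rshift m i) (fun y => g (lsubmx y)) y = 0.
Proof.
have e : (fun t : R => g (lsubmx (t *: delta_mx 0 (rshift m i) + y))) =
         cst (g (lsubmx y)).
  by apply/funext => t; rewrite lsubmx_line lsubmx_d_mu scaler0 add0r.
by rewrite /partial [LHS]derive_line e derive_cst.
Qed.

Lemma row_mx_line (t : R) (u : 'rV[R]_m) (v w : 'rV[R]_n) :
  row_mx u (t *: v + w) = t *: row_mx 0 v + row_mx u w.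
Proof. by rewrite scale_row_mx scaler0 add_row_mx add0r. Qed.

Lemma smooth_on_row_mx0 (V : set 'rV[R]_(m + n)) (g : 'rV[R]_(m + n) -> R) :
  smooth_on V g ->
  smooth_on [set u : 'rV[R]_m | V (row_mx u 0)] (fun u => g (row_mx u 0)).
Proof.
move=> + k; elim: k g => [|k IH] g gs.
  move=> u Vu; apply: (@continuous_comp _ _ _ (fun u : 'rV[R]_m => row_mx u 0) g).
    move=> W /nbhs_ballP[e e0 We]; apply/nbhs_ballP; exists e => // z uz; apply: We.
    move: uz; rewrite -!ball_normE /ball_/=; apply: le_lt_trans.
    rewrite opp_row_mx add_row_mx subr0; apply: rV_norm_le => // i.
    case: (split_ordP i) => l ->; first by rewrite row_mxEl rV_coord_le.
    by rewrite row_mxEr mxE normr0.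
  exact: (gs 0%N).
have line i u : (fun t : R => g (row_mx (t *: delta_mx 0 i + u) 0)) =
    (fun t : R => g (t *: delta_mx 0 (lshift n i) + row_mx u 0)).
  apply/funext => t; congr g; rewrite -[delta_mx 0 (lshift n i)]hsubmxK.
  by rewrite lsubmx_d_x rsubmx_d_x scale_row_mx scaler0 add_row_mx addr0.
move/smooth_onP: gs => [_ dg sg] i; split=> [u /(dg (lshift n i))/derivable1P|].
  by rewrite -line => dgu; apply/derivable1P.
have -> : partial i (fun u => g (row_mx u 0)) =
    fun u => partial (lshift n i) g (row_mx u 0).
  by apply/funext => u; rewrite /partial derive_line line -derive_line.
exact: IH.
Qed.

End SplitCoordinates.

Section DualBundle.
Context {R : realType} {m n : nat} {M : manifold R m} {A : vector_bundle M n}.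
Local Notation At := (dual_atlas A).
Implicit Types (c : chart At) (p : dual_total A) (x : M) (j : triv A).
Implicit Types (mu eta : forall x, fiber A x) (f g : M -> R).

Definition form_at j x (a : 'rV[R]_n) : dual_total A :=
  existT _ x (@coform _ _ _ _ A j x a : {scalar fiber A x}).

Lemma form_at0 j k x : form_at j x 0 = form_at k x 0.
Proof.
congr existT; apply: scalar_eq => v.
by rewrite /= /coform !big1// => i _; rewrite mxE mul0r.
Qed.

(** The zero covector is the same in every frame, by [form_at0]. *)
Definition zero_at x : dual_total A := form_at (triv_at A x) x 0.

Lemma form_atK j p : vdom j (dual_proj p) ->
  form_at j (dual_proj p) (\row_i dual_form p (frame j (dual_proj p) i)) = p.
Proof.
case: p => x a /= jx; congr existT; apply: scalar_eq => v /=.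
rewrite /coform -[v in RHS](coordK _ jx) linear_sum.
by apply: eq_bigr => i _; rewrite linearZ mxE mulrC.
Qed.

Lemma dual_pt_row_mx c x (a : 'rV[R]_n) : cdom c.1 x ->
  dual_pt c (row_mx (co c.1 x) a) = form_at c.2 x a.
Proof. by move=> cx; rewrite /dual_pt row_mxKl row_mxKr coK. Qed.

Lemma dual_co_form_at c x (a : 'rV[R]_n) : vdom c.2 x ->
  dual_co c (form_at c.2 x a) = row_mx (co c.1 x) a.
Proof.
move=> jx; rewrite /dual_co; congr row_mx.
by apply/rowP => i; rewrite mxE; exact: coform_frame.
Qed.

Lemma dual_pt_zero c (u : 'rV[R]_m) : dual_pt c (row_mx u 0) = zero_at (pt c.1 u).
Proof. by rewrite /dual_pt row_mxKl row_mxKr; exact: form_at0. Qed.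

Lemma dual_co_zero c x : dual_co c (zero_at x) = row_mx (co c.1 x) 0.
Proof.
rewrite /dual_co; congr row_mx; apply/rowP => i; rewrite !mxE /=.
by rewrite /coform big1// => k _; rewrite mxE mul0r.
Qed.

Lemma linfun_form_at mu j x (a : 'rV[R]_n) :
  linfun mu (form_at j x a) = \sum_i a 0 i * coord j x (mu x) 0 i.
Proof. by []. Qed.

Lemma dual_separates x (u v : fiber A x) :
  (forall a : {scalar fiber A x}, a u = a v) -> u = v.
Proof.
move=> uv; have jx := triv_atP A x; set j := triv_at A x in jx.
rewrite -(coordK u jx) -(coordK v jx); apply: eq_bigr => i _.
have pick w : coform j (delta_mx 0 i) w = coord j x w 0 i.
  rewrite /coform (bigD1 i)//= mxE !eqxx mul1r big1 ?addr0// => k ki.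
  by rewrite mxE eqxx (negbTE ki) mul0r.
by rewrite -!pick (uv (@coform _ _ _ _ A j x (delta_mx 0 i) : {scalar fiber A x})).
Qed.

Lemma dual_domain c : dual_co c @` dual_cdom c =
  [set y : 'rV[R]_(m + n) | (co c.1 @` (cdom c.1 `&` vdom c.2)) (lsubmx y)].
Proof.
by rewrite -[dual_cdom c]setIid dual_co_image setIA setIid.
Qed.

Lemma dual_domain_open c : open (dual_co c @` dual_cdom c).
Proof. exact: (@co_image_openT _ _ _ At c). Qed.

Lemma smooth_linfun mu : smooth_section mu -> smooth_fun At (linfun mu).
Proof.
move=> smu; apply/smooth_funP => c.
have oU := @dual_domain_open c.
apply: (@eq_smooth_on _ _ _ (fun y : 'rV[R]_(m + n) => \sum_i y 0 (rshift m i) *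
    coord c.2 (pt c.1 (lsubmx y)) (mu (pt c.1 (lsubmx y))) 0 i)) => //.
  move=> y _; rewrite /= /linfun /dual_pt /coform /=.
  by apply: eq_bigr => i _; rewrite mxE.
apply: smooth_on_sum => // i; apply: smooth_onM => //; first exact: smooth_on_coord.
apply: smooth_on_sub (@smooth_on_lsubmx R m n (co c.1 @` (cdom c.1 `&` vdom c.2))
  (fun u => coord c.2 (pt c.1 u) (mu (pt c.1 u)) 0 i) (smu c.2 i c.1)).
by move=> y Uy; rewrite -dual_domain.
Qed.

Lemma smooth_basic f : smooth_fun M f -> smooth_fun At (f \o @dual_proj _ _ _ _ A).
Proof.
move=> sf; apply/smooth_funP => c.
apply: smooth_on_sub (@smooth_on_lsubmx R m n _ (f \o pt c.1) (sf c.1)).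
move=> y; rewrite [X in X y -> _]dual_domain => -[x [cx _] xy] /=.
by exists x.
Qed.

Lemma dpartial_basic_x c l f p : cdom c p ->
  dpartial c (lshift n l) (f \o @dual_proj _ _ _ _ A) p = dpartial c.1 l f (dual_proj p).
Proof.
move=> cp; have := @partial_lsubmx_l R m n l (f \o pt c.1) (dual_co c p).
by rewrite row_mxKl.
Qed.

Lemma dpartial_basic_mu c i f p :
  dpartial c (rshift m i) (f \o @dual_proj _ _ _ _ A) p = 0.
Proof. exact: (@partial_lsubmx_r R m n i (f \o pt c.1) (dual_co c p)). Qed.

Lemma dpartial_linfun_mu c i mu p : cdom c p ->
  dpartial c (rshift m i) (linfun mu) p = coord c.2 (dual_proj p) (mu (dual_proj p)) 0 i.
Proof.
move=> [cx jx]; set x := dual_proj p; set y := dual_co c p.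
have e : (fun t : R => (linfun mu \o dual_pt c) (t *: delta_mx 0 (rshift m i) + y)) =
    (fun t : R => t * coord c.2 x (mu x) 0 i + linfun mu (dual_pt c y)).
  apply/funext => t; rewrite /= /linfun /dual_pt /= lsubmx_line lsubmx_d_mu scaler0 add0r.
  rewrite rsubmx_line rsubmx_d_mu [lsubmx y]row_mxKl coK// /coform.
  rewrite (bigD1 i)//= [in RHS](bigD1 i)//= addrA; congr (_ + _).
    by rewrite !mxE !eqxx mulr1 mulrDl.
  by apply: eq_bigr => k ki; rewrite !mxE eqxx (negbTE ki) mulr0 add0r.
rewrite /dpartial /partial derive_line e.
have D := is_deriveD (is_derive_fmul (is_derive_id (0 : R) (1 : R))
  (is_derive_cst (coord c.2 x (mu x) 0 i) (0 : R) (1 : R)))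
  (is_derive_cst (linfun mu (dual_pt c y)) (0 : R) (1 : R)).
by rewrite (@derive_val _ _ _ _ _ _ _ D) mulr0 mul1r !addr0.
Qed.

(** A linear function vanishes identically along the zero section, and moving x with the fibre
    coordinates held at 0 stays on it. *)
Lemma dpartial_linfun_zero c l mu x :
  dpartial c (lshift n l) (linfun mu) (zero_at x) = 0.
Proof.
have e : (fun t : R => (linfun mu \o dual_pt c)
    (t *: delta_mx 0 (lshift n l) + dual_co c (zero_at x))) = cst 0.
  apply/funext => t; rewrite /= /linfun /dual_pt /= rsubmx_line rsubmx_d_x.
  rewrite dual_co_zero row_mxKr scaler0 addr0 /coform big1// => k _.
  by rewrite mxE mul0r.
by rewrite /dpartial /partial derive_line e derive_cst.
Qed.

Lemma smooth_zero_restrict (h : dual_total A -> R) : smooth_fun At h ->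
  smooth_fun M (h \o zero_at).
Proof.
move=> sh; apply/smooth_funP => c; apply: smooth_on_local => _ [x cx <-].
pose C : chart At := (c, triv_at A x); have /smooth_funP/(_ C) sC := sh.
exists [set u : 'rV[R]_m | (dual_co C @` dual_cdom C) (row_mx u 0)].
exists (fun u => (h \o dual_pt C) (row_mx u 0)); split.
- by exists (zero_at x); [split=> //; exact: triv_atP|exact: dual_co_zero].
- exact: (smooth_on_row_mx0 sC).
- by apply: (@filterE _ (nbhs (co c x))) => u; rewrite /= dual_pt_zero.
Qed.

Lemma continuous_fiber_line (h : dual_total A -> R) j x (v w : 'rV[R]_n) (t : R) :
  smooth_fun At h -> vdom j x ->
  {for t, continuous (fun s : R => h (form_at j x (s *: v + w)))}.
Proof.
move=> sh jx; have cx := chart_atP M x.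
pose C : chart At := (chart_at M x, j); have /smooth_funP/(_ C)/smooth_onP[ch _ _] := sh.
have e : (fun s : R => h (form_at j x (s *: v + w))) =
    (h \o dual_pt C) \o (fun s : R => s *: row_mx 0 v + row_mx (co C.1 x) w).
  by apply/funext => s; rewrite /= -row_mx_line dual_pt_row_mx.
rewrite e; apply: continuous_comp; last first.
  apply: ch; exists (form_at j x (t *: v + w)) => //.
  by apply: etrans (@dual_co_form_at C x _ jx) _; rewrite row_mx_line.
apply: continuousD; last exact: cst_continuous.
exact: scalel_continuous.
Qed.

Lemma smooth_section_comb f mu eta : smooth_fun M f ->
  smooth_section mu -> smooth_section eta ->
  smooth_section (fun x => f x *: mu x + eta x).
Proof.
move=> sf smu seta j l c; have oU := co_image_open (c := c) (vdom_open j).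
apply: (@eq_smooth_on _ _ _ (fun y => f (pt c y) * coord j (pt c y) (mu (pt c y)) 0 l
   + coord j (pt c y) (eta (pt c y)) 0 l)) => //.
  by move=> y _; rewrite /= linearP !mxE.
apply: smooth_onD => //; last exact: seta.
apply: smooth_onM => //; last exact: smu.
by apply: smooth_on_sub (sf c) => _ [x [cx _] <-]; exists x.
Qed.

Lemma smooth_section0 : smooth_section (fun x => 0 : fiber A x).
Proof.
move=> j l c; apply: (@eq_smooth_on _ _ _ (fun=> 0)).
- exact: co_image_open (vdom_open j).
- by move=> y _; rewrite /= linear0 mxE.
exact: smooth_on_cst.
Qed.

Lemma smooth_sectionZ f mu : smooth_fun M f -> smooth_section mu ->
  smooth_section (fun x => f x *: mu x).
Proof.
move=> sf smu; have := smooth_section_comb sf smu smooth_section0.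
by congr smooth_section; apply: functional_extensionality_dep => x; rewrite addr0.
Qed.

Lemma linfun_comb f mu eta : linfun (fun x => f x *: mu x + eta x) =
  fun p => (f \o @dual_proj _ _ _ _ A) p * linfun mu p + linfun eta p.
Proof. by apply/funext => p; rewrite /linfun linearP. Qed.

Lemma linfunZ f mu : linfun (fun x => f x *: mu x) =
  fun p => (f \o @dual_proj _ _ _ _ A) p * linfun mu p.
Proof. by apply/funext => p; rewrite /linfun linearZ. Qed.

Lemma linfun_frame j x i s (a : 'rV[R]_n) : vdom j x -> s x = frame j x i ->
  linfun s (form_at j x a) = a 0 i.
Proof. by move=> jx sx; rewrite /linfun /dual_form /= sx; exact: coform_frame. Qed.

(** A single section suffices, equal to e_i near x for one frame index i; such an index exists
    because n > 0. Along a line t e^i + w with w_i = 0 its linear function is t, so t h is constant,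
    being basic, and vanishes at t = 0. Hence h = 0 for t != 0, and the remaining covector of the
    line is reached by continuity. *)
Lemma basic_mul_eq0 (n_gt0 : (0 < n)%N) (h : dual_total A -> R) : smooth_fun At h ->
  (forall mu, smooth_section mu -> basic_function (fun p => linfun mu p * h p)) ->
  forall p, h p = 0.
Proof.
move=> sh bas p; pose x := dual_proj p; pose j := triv_at A x.
have jx : vdom j x := triv_atP A x; pose i := Ordinal n_gt0.
have [s [ss sx]] := extend_frame i jx; move/nbhs_singleton in sx.
rewrite -(form_atK jx); set a := \row__ _.
pose w := a - a 0 i *: delta_mx 0 i.
have -> : a = a 0 i *: delta_mx 0 i + w by rewrite addrC subrK.
have [f _ sf] := bas s ss.
have key t : t * h (form_at j x (t *: delta_mx 0 i + w)) = 0.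
  have val r : r * h (form_at j x (r *: delta_mx 0 i + w)) = f x.
    have := congr1 (fun F => F (form_at j x (r *: delta_mx 0 i + w))) sf.
    rewrite /= (linfun_frame _ jx sx) /w !mxE !eqxx !mulr1 subrr addr0.
    by move=> ->.
  by rewrite val -(val 0) mul0r.
have ne0 t : t != 0 -> h (form_at j x (t *: delta_mx 0 i + w)) = 0.
  by move=> t0; apply/eqP; have /eqP := key t; rewrite mulf_eq0 (negbTE t0).
have [e|] := eqVneq (a 0 i) 0; last exact: ne0.
rewrite e; apply: (punctured_const (k := fun t => h (form_at j x (t *: delta_mx 0 i + w)))) => //.
exact: continuous_fiber_line.
Qed.

Lemma linear_mul_const (h : dual_total A -> R) : smooth_fun At h ->
  (forall mu, smooth_section mu -> linear_function (fun p => linfun mu p * h p)) ->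
  forall p, h p = h (zero_at (dual_proj p)).
Proof.
move=> sh lin p; pose x := dual_proj p; pose j := triv_at A x.
have jx : vdom j x := triv_atP A x.
rewrite -[in LHS](form_atK jx) -/x; set a := \row__ _; rewrite /zero_at -/x -/j.
clearbody a; have [->//|a0] := eqVneq a 0.
have [i ai] : exists i, a 0 i != 0.
  apply/existsP; apply: contraNT a0; rewrite negb_exists => /forallP a0.
  by apply/eqP/rowP => i; rewrite mxE; apply/eqP; have := a0 i; rewrite negbK.
have [s [ss sx]] := extend_frame i jx; move/nbhs_singleton in sx.
have [nu _ e] := lin s ss.
(* With s = e_i near x, the product s~ h is a linear function nu~; both s~ and nu~ are homogeneous
   along the ray through a, so for t != 0 the factors t and a_i cancel and h(t a) = h(a). Continuity
   then reaches the zero covector. *)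
have scale t : t * a 0 i * h (form_at j x (t *: a + 0)) = t * linfun nu (form_at j x a).
  have := congr1 (fun F => F (form_at j x (t *: a + 0))) e.
  rewrite /= (linfun_frame _ jx sx) !mxE addr0 => ->.
  rewrite !linfun_form_at mulr_sumr; apply: eq_bigr => k _.
  by rewrite !mxE addr0 mulrA.
have scale1 : a 0 i * h (form_at j x a) = linfun nu (form_at j x a).
  by have := scale 1; rewrite scale1r addr0 !mul1r.
suff <- : h (form_at j x (0 *: a + 0)) = h (form_at j x a) by rewrite scale0r addr0.
apply: (punctured_const (k := fun t => h (form_at j x (t *: a + 0)))).
  exact: continuous_fiber_line.
move=> t t0; apply: (mulfI ai); apply: (mulfI t0).
by rewrite mulrA scale scale1.
Qed.

End DualBundle.

(** * The Lie algebroid of a Jacobi structure *)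

Section JacobiToLie.
Context {R : realType} {m n : nat} {M : manifold R m} {A : vector_bundle M n}.
Local Notation At := (dual_atlas A).
Local Notation bas f := (f \o @dual_proj R m n M A).
Implicit Types (x : M) (mu eta theta : forall x, fiber A x) (f g : M -> R).

Variables (n_gt0 : (0 < n)%N) (L : bivector_field At) (E : vector_field At).
Local Notation "{[ F , G ]}" := (jacobi_bracket L E F G).
Hypothesis LE : jacobi_structure L E.
Hypothesis C1 : forall F G : dual_total A -> R,
  linear_function F -> linear_function G -> linear_function {[F, G]}.
Hypothesis C2 : forall F : dual_total A -> R,
  linear_function F -> basic_function {[F, fun=> 1]}.

Let linear_linfun mu : smooth_section mu -> linear_function (linfun mu).
Proof. by exists mu. Qed.

Lemma smooth_funB f g : smooth_fun M f -> smooth_fun M g ->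
  smooth_fun M (fun x => f x - g x).
Proof.
move=> sf sg; have -> : (fun x => f x - g x) = (fun x => f x + -1 * g x).
  by apply/funext => x; rewrite mulN1r.
by apply: smooth_funD => //; apply: smooth_funM => //; exact: smooth_fun_cst.
Qed.

Lemma vf_apply_basic f p : smooth_fun M f -> vf_apply (comp1 E) (bas f) p = 0.
Proof.
move=> sf; have sbf := smooth_basic (A := A) sf.
apply: (basic_mul_eq0 n_gt0 (smooth_vf_apply E sbf)) => mu smu.
have [g1 sg1 e1] := C2 (linear_linfun (smooth_sectionZ sf smu)).
have [g2 sg2 e2] := C2 (linear_linfun smu).
(* The order of the difference is reversed because {mu~, 1} = - E(mu~). *)
exists (fun x => f x * g2 x - g1 x).
  by apply: smooth_funB => //; exact: smooth_funM.
apply/funext => q; rewrite /= -[g1 _]/((g1 \o @dual_proj _ _ _ _ A) q) -e1.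
rewrite -[g2 _]/((g2 \o @dual_proj _ _ _ _ A) q) -e2 !jacobi_bracket1 linfunZ.
by have slmu := smooth_linfun smu; rewrite vf_applyM//=; ring.
Qed.

Let bracket_leibniz mu eta f p : smooth_section mu -> smooth_section eta -> smooth_fun M f ->
  {[linfun mu, linfun (fun x => f x *: eta x)]} p =
  f (dual_proj p) * {[linfun mu, linfun eta]} p
  + linfun eta p * bf_apply (comp2 L) (linfun mu) (bas f) p.
Proof.
move=> smu seta sf; have sbf := smooth_basic (A := A) sf.
have sleta := smooth_linfun seta; rewrite linfunZ jacobi_bracketM// vf_apply_basic//=.
by rewrite mulr0 addr0.
Qed.

(** The evaluation at the zero covector gives a function on M, smooth by restriction, before
    constancy along the fibres is established. *)
Definition rho mu f x : R := bf_apply (comp2 L) (linfun mu) (bas f) (zero_at x).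

Lemma smooth_rho mu f : smooth_section mu -> smooth_fun M f -> smooth_fun M (rho mu f).
Proof.
move=> smu sf; apply: smooth_zero_restrict.
by apply: smooth_bf_apply; [exact: smooth_linfun|exact: smooth_basic].
Qed.

Lemma bf_apply_linfun_basic mu f p : smooth_section mu -> smooth_fun M f ->
  bf_apply (comp2 L) (linfun mu) (bas f) p = rho mu f (dual_proj p).
Proof.
move=> smu sf; have sbf := smooth_basic (A := A) sf; have slmu := smooth_linfun smu.
apply: (linear_mul_const (smooth_bf_apply L slmu sbf)) => eta seta.
have [nu1 snu1 e1] := C1 (linear_linfun smu) (linear_linfun (smooth_sectionZ sf seta)).
have [nu2 snu2 e2] := C1 (linear_linfun smu) (linear_linfun seta).
(* Because E(f o pi) = 0, the Leibniz rule gives eta~ L(d mu~, d(f o pi)) = {mu~, (f eta)~} - f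
   {mu~, eta~}. *)
exists (fun x => (- f x) *: nu2 x + nu1 x).
  apply: smooth_section_comb => //.
  have -> : (fun x => - f x) = (fun x => -1 * f x) by apply/funext => x; rewrite mulN1r.
  by apply: smooth_funM => //; exact: smooth_fun_cst.
apply/funext => q; rewrite linfun_comb -e1 -e2 bracket_leibniz//=; ring.
Qed.

Lemma bf_apply_basic f g p : smooth_fun M f -> smooth_fun M g ->
  bf_apply (comp2 L) (bas f) (bas g) p = 0.
Proof.
move=> sf sg; have sbf := smooth_basic (A := A) sf; have sbg := smooth_basic (A := A) sg.
apply: (basic_mul_eq0 n_gt0 (smooth_bf_apply L sbf sbg)) => mu smu.
have slmu := smooth_linfun smu; have sfmu := smooth_sectionZ sf smu.
(* The derivation rule applied to (f mu)~ = (f o pi) mu~ writes mu~ L(d(f o pi), d(g o pi)) as this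
   difference of two basic functions. *)
exists (fun x => rho (fun x => f x *: mu x) g x - f x * rho mu g x).
  by apply: smooth_funB; [|apply: smooth_funM => //]; exact: smooth_rho.
have e q : bf_apply (comp2 L) (linfun (fun x => f x *: mu x)) (bas g) q =
    f (dual_proj q) * bf_apply (comp2 L) (linfun mu) (bas g) q
    + linfun mu q * bf_apply (comp2 L) (bas f) (bas g) q.
  rewrite linfunZ bf_applyC bf_applyM// (bf_applyC L (bas g) (linfun mu)).
  by rewrite (bf_applyC L (bas g)) /=; ring.
by apply/funext => q; rewrite /= -!bf_apply_linfun_basic// e; ring.
Qed.

(** Dictated by the expected equality E = - phi^v, read on the fibre components at the zero
    covector. *)
Definition cocycle_form x : {scalar fiber A x} :=
  @coform _ _ _ _ A (triv_at A x) x
    (\row_i - E (zero_at x) (chart_at At (zero_at x)) 0 (rshift m i)).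

Lemma cocycle_formE mu x : smooth_section mu ->
  cocycle_form x (mu x) = - vf_apply (comp1 E) (linfun mu) (zero_at x).
Proof.
move=> smu; rewrite /vf_apply big_split_ord/= big1 ?add0r => [|l _]; last first.
  by rewrite dpartial_linfun_zero mulr0.
rewrite -sumrN; apply: eq_bigr => i _.
rewrite dpartial_linfun_mu ?mxE ?mulNr//; exact: (chart_atP At (zero_at x)).
Qed.

Lemma bracket_one mu p : smooth_section mu ->
  {[linfun mu, fun=> 1]} p = cocycle_form (dual_proj p) (mu (dual_proj p)).
Proof.
move=> smu; have [f _ e] := C2 (linear_linfun smu).
by rewrite cocycle_formE// -(jacobi_bracket1 L) e.
Qed.

Lemma vf_apply_linfun mu p : smooth_section mu ->
  vf_apply (comp1 E) (linfun mu) p = - cocycle_form (dual_proj p) (mu (dual_proj p)).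
Proof. by move=> smu; rewrite -bracket_one// jacobi_bracket1 opprK. Qed.

Lemma smooth_cocycle_form mu : smooth_section mu ->
  smooth_fun M (fun x => cocycle_form x (mu x)).
Proof.
move=> smu; have -> : (fun x => cocycle_form x (mu x)) = {[linfun mu, fun=> 1]} \o zero_at.
  by apply/funext => x; rewrite /= bracket_one.
apply/smooth_zero_restrict/smooth_jacobi_bracket; first exact: smooth_linfun.
exact: smooth_fun_cst.
Qed.

(** * The anchor at a point, from the mixed components of L *)

Section AnchorAt.
Context (x : M) (v : fiber A x).
Local Notation j := (triv_at A x).
Local Notation z := (zero_at x).

(** The anchor must be defined on single vectors and in all charts, so it is given by the components
    L(d mu_i, dx^l) at the zero covector instead of by the operators [rho mu]. *)
Definition anchor_comp (c : chart M) : 'rV[R]_m :=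
  \row_l \sum_i coord j x v 0 i * L z ((c, j) : chart At) (rshift m i) (lshift n l).

(** The two bundle charts share the frame at x, so the Jacobian matrix between them is block
    diagonal, with the Jacobian of the base charts and an identity block; the mixed components of L
    thus change like a tangent vector. *)
Lemma anchor_comp_change c c' : cdom c x -> cdom c' x ->
  anchor_comp c' = anchor_comp c *m jacobian c c' x.
Proof.
move=> cx c'x; have jx : vdom j x := triv_atP A x.
pose C : chart At := (c, j); pose C' : chart At := (c', j).
have Cz : cdom C z by split. have C'z : cdom C' z by split.
have J_mu a i : jacobian C C' z a (rshift m i) = (a == rshift m i)%:R.
  have e : (fun q => co C' q 0 (rshift m i)) = linfun (fun x => frame j x i).
    by apply/funext => q; rewrite /= row_mxEr mxE.
  rewrite mxE e {e}.
  case: (split_ordP a) => k ->; first by rewrite dpartial_linfun_zero eq_lrshift.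
  rewrite dpartial_linfun_mu// coord_frame// mxE (inj_eq (@rshift_inj _ _)) eqxx/=.
  by rewrite eq_sym.
have J_x b l : jacobian C C' z b (lshift n l) =
    if fintype.split b is inl k then jacobian c c' x k l else 0.
  have e : (fun q => co C' q 0 (lshift n l)) = bas (fun y => co c' y 0 l).
    by apply/funext => q; rewrite /= row_mxEl.
  rewrite mxE e {e}.
  case: split_ordP => k ->; last exact: dpartial_basic_mu.
  by rewrite dpartial_basic_x// mxE.
apply/rowP => l; rewrite !mxE.
under [RHS]eq_bigr do rewrite mxE mulr_suml.
rewrite [RHS]exchange_big/=; apply: eq_bigr => i _.
rewrite -[RHS]/(\sum_k _ * _ * _); under [RHS]eq_bigr do rewrite -mulrA.
rewrite -mulr_sumr; congr (_ * _).
have -> : L z C' = (jacobian C C' z)^T *m L z C *m jacobian C C' z by exact: bcomp_change.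
rewrite mxE big_split_ord/= [X in _ + X]big1 ?addr0 => [|k _]; last first.
  by rewrite J_x (unsplitK (inr k)) mulr0.
apply: eq_bigr => k _; rewrite J_x (unsplitK (inl k)); congr (_ * _).
rewrite mxE (bigD1 (rshift m i))//= mxE J_mu eqxx mul1r big1 ?addr0// => a ai.
by rewrite mxE J_mu (negbTE ai) mul0r.
Qed.

Definition anchor_of : tangent M x := Tangent anchor_comp_change.

End AnchorAt.

(** Both sides unfold in the same coordinates: the preferred chart at the zero covector over x
    consists of the preferred chart and frame at x. *)
Lemma vf_apply_anchor mu f x :
  vf_apply (fun y (c : chart M) => anchor_of (mu y) c) f x = rho mu f x.
Proof.
rewrite /rho /bf_apply big_split_ord/= big1 ?add0r => [|l _]; last first.
  by rewrite big1// => k _; rewrite dpartial_linfun_zero mulr0 mul0r.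
have Cz := chart_atP At (zero_at x).
rewrite /vf_apply; under [LHS]eq_bigr do rewrite mxE mulr_suml.
rewrite [LHS]exchange_big/=; apply: eq_bigr => i _.
rewrite big_split_ord/= [X in _ + X]big1 ?addr0 => [|k _]; last first.
  by rewrite dpartial_basic_mu mulr0.
apply: eq_bigr => l _; rewrite dpartial_basic_x// dpartial_linfun_mu//.
by congr (_ * _); rewrite mulrC.
Qed.

(** A component of the anchor in any chart is its value on a global function that agrees with the
    coordinate near x; this transfers statements about [rho] to components. *)
Lemma anchor_of_rho mu f x c l : cdom c x -> (\forall y \near x, f y = co c y 0 l) ->
  anchor_of (mu x) c 0 l = rho mu f x.
Proof.
move=> cx fx; have c0x := chart_atP M x.
rewrite (tcomp_change (anchor_of (mu x)) c0x cx) mxE -vf_apply_anchor.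
apply: eq_bigr => i _; congr (_ * _); rewrite [LHS]mxE.
apply: near_eq_dpartial; apply: (near_pt (P := fun y => co c y 0 l = f y)) => //.
by apply: filterS fx => y ->.
Qed.

(** For smooth sections (C1) provides a section representing the bracket, and choice selects it; it
    is unique since covectors separate vectors. The zero default makes the operation total. *)
Definition section_bracket mu eta : forall x, fiber A x :=
  if pselect (exists2 nu, smooth_section nu & {[linfun mu, linfun eta]} = linfun nu)
  is left h then s2val (cid2 h) else fun=> 0.

Lemma section_bracketP mu eta : smooth_section mu -> smooth_section eta ->
  smooth_section (section_bracket mu eta) /\
  {[linfun mu, linfun eta]} = linfun (section_bracket mu eta).
Proof.
move=> smu seta; rewrite /section_bracket; case: pselect => [h|[]]; first by case: cid2.
by apply: C1; exact: linear_linfun.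
Qed.

Let bracketP mu eta smu seta := (@section_bracketP mu eta smu seta).2.
Let smooth_bracket mu eta smu seta := (@section_bracketP mu eta smu seta).1.

Let jacobi_leibniz (F G H : dual_total A -> R) p :
  smooth_fun At F -> smooth_fun At G -> smooth_fun At H ->
  {[F, {[G, H]}]} p = {[{[F, G]}, H]} p + {[G, {[F, H]}]} p.
Proof.
move=> sF sG sH; have := jacobi_bracket_jacobi LE p sF sG sH.
have -> : {[H, F]} = fun q => -1 * {[F, H]} q.
  by apply/funext => q; rewrite mulN1r jacobi_bracketC.
rewrite jacobi_bracketM ?bf_apply_cst ?vf_apply_cst; last 2 first.
- exact: smooth_fun_cst.
- exact: smooth_jacobi_bracket.
rewrite (jacobi_bracketC L E H).
by move: ({[F, {[G, H]}]} p) ({[{[F, G]}, H]} p) ({[G, {[F, H]}]} p) => a b c e; lra.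
Qed.

(** The operator f -> rho(mu) f + phi(mu) f is the action on functions twisted by phi; the term f
    phi(mu) comes from - f E(mu~). *)
Let bracket_basic mu f : smooth_section mu -> smooth_fun M f ->
  {[linfun mu, bas f]} = bas (fun x => rho mu f x + f x * cocycle_form x (mu x)).
Proof.
move=> smu sf; apply/funext => p; rewrite /jacobi_bracket bf_apply_linfun_basic//.
by rewrite vf_apply_basic// vf_apply_linfun//=; ring.
Qed.

Lemma cocycle_form_bracket mu eta x : smooth_section mu -> smooth_section eta ->
  cocycle_form x (section_bracket mu eta x) =
  rho mu (fun y => cocycle_form y (eta y)) x - rho eta (fun y => cocycle_form y (mu y)) x.
Proof.
move=> smu seta; have slmu := smooth_linfun smu; have sleta := smooth_linfun seta.
have br1 nu : smooth_section nu -> {[linfun nu, fun=> 1]} = bas (fun y => cocycle_form y (nu y)).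
  by move=> snu; apply/funext => p; rewrite bracket_one.
have scmu := smooth_cocycle_form smu; have sceta := smooth_cocycle_form seta.
have := jacobi_leibniz (zero_at x) slmu sleta (smooth_fun_cst 1).
rewrite bracketP// !br1//; last exact: smooth_bracket.
(* Both iterated brackets contain phi(mu) phi(eta), which cancels in their difference. *)
by rewrite !bracket_basic//= => e; lra.
Qed.

Lemma rho_bracket mu eta f x :
  smooth_section mu -> smooth_section eta -> smooth_fun M f ->
  rho (section_bracket mu eta) f x = rho mu (rho eta f) x - rho eta (rho mu f) x.
Proof.
move=> smu seta sf; have slmu := smooth_linfun smu; have sleta := smooth_linfun seta.
have sbf := smooth_basic (A := A) sf; have snu := smooth_bracket smu seta.
have := jacobi_leibniz (zero_at x) slmu sleta sbf.
(* In the difference of this expansion for (mu, eta) and (eta, mu) the terms symmetric in the two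
   sections cancel. What remains in phi, f times rho(mu)(phi(eta)) - rho(eta)(phi(mu)), equals f phi
   of the bracket by the cocycle identity. *)
have T nu1 nu2 : smooth_section nu1 -> smooth_section nu2 ->
    {[linfun nu1, {[linfun nu2, bas f]}]} (zero_at x) =
    rho nu1 (rho nu2 f) x + f x * rho nu1 (fun y => cocycle_form y (nu2 y)) x
    + cocycle_form x (nu2 x) * rho nu1 f x
    + (rho nu2 f x + f x * cocycle_form x (nu2 x)) * cocycle_form x (nu1 x).
  move=> s1 s2; have scf2 := smooth_cocycle_form s2; have sr2 := smooth_rho s2 sf.
  have sfc : smooth_fun M (fun x => f x * cocycle_form x (nu2 x)) by exact: smooth_funM.
  rewrite bracket_basic// bracket_basic//=; last exact: smooth_funD.
  congr (_ + _); rewrite {1}/rho.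
  have sbr2 := smooth_basic (A := A) sr2; have sbc := smooth_basic (A := A) scf2.
  have sbfc := smooth_basic (A := A) sfc.
  rewrite -[bas (fun x => _)]/(fun q => bas (rho nu2 f) q + bas (fun x => f x * cocycle_form x (nu2 x)) q).
  rewrite bf_applyD// -addrA; congr (_ + _).
  rewrite -[bas (fun x => _)]/(fun q => bas f q * bas (fun x => cocycle_form x (nu2 x)) q).
  by rewrite bf_applyM.
rewrite !T// bracketP// bracket_basic//= cocycle_form_bracket//.
move: (rho (section_bracket mu eta) f x) (rho mu (rho eta f) x) (rho eta (rho mu f) x)
  (rho mu f x) (rho eta f x) (rho mu (fun y => cocycle_form y (eta y)) x)
  (rho eta (fun y => cocycle_form y (mu y)) x) (cocycle_form x (mu x))
  (cocycle_form x (eta x)) (f x) => r1 r2 r3 r4 r5 r6 r7 r8 r9 r10 e; lra.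
Qed.

(** Every covector is a point of the dual bundle, and covectors separate vectors, so each axiom of
    the bracket of sections becomes an identity between Jacobi brackets of functions. *)
Let bracket_form mu eta x (a : {scalar fiber A x}) :
  smooth_section mu -> smooth_section eta ->
  a (section_bracket mu eta x) = {[linfun mu, linfun eta]} (existT _ x a).
Proof. by move=> smu seta; rewrite bracketP. Qed.

Let section_bracket_linear (a : R) mu mu' eta :
  smooth_section mu -> smooth_section mu' -> smooth_section eta ->
  forall x, section_bracket (fun y => a *: mu y + mu' y) eta x
            = a *: section_bracket mu eta x + section_bracket mu' eta x.
Proof.
move=> smu smu' seta x; have slmu := smooth_linfun smu.
have slmu' := smooth_linfun smu'; have sa := @smooth_fun_cst _ _ _ M a.
have sca := @smooth_fun_cst _ _ _ At a.
apply: dual_separates => b; rewrite linearP !bracket_form//; last first.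
  exact: smooth_section_comb.
rewrite (linfun_comb (fun=> a)) jacobi_bracketC jacobi_bracketD//; last first.
  exact: (smooth_funM sca slmu).
rewrite (jacobi_bracketM L E (linfun eta) (existT _ x b) sca slmu).
rewrite bf_apply_cst vf_apply_cst !(jacobi_bracketC L E (linfun eta)).
by rewrite mulr0 addr0 mulr0 addr0 mulrN -opprD opprK.
Qed.

Let section_bracket_anti mu eta : smooth_section mu -> smooth_section eta ->
  forall x, section_bracket mu eta x = - section_bracket eta mu x.
Proof.
move=> smu seta x; apply: dual_separates => a.
by rewrite linearN !bracket_form//= jacobi_bracketC.
Qed.

Let section_bracket_jacobi mu eta theta :
  smooth_section mu -> smooth_section eta -> smooth_section theta ->
  forall x, section_bracket mu (section_bracket eta theta) x
    + section_bracket eta (section_bracket theta mu) x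
    + section_bracket theta (section_bracket mu eta) x = 0.
Proof.
move=> smu seta sth x; apply: dual_separates => a.
have s1 := smooth_bracket seta sth; have s2 := smooth_bracket sth smu.
have s3 := smooth_bracket smu seta.
have e1 := bracket_form a smu s1; have e2 := bracket_form a seta s2.
have e3 := bracket_form a sth s3.
rewrite -(bracketP seta sth) in e1; rewrite -(bracketP sth smu) in e2.
rewrite -(bracketP smu seta) in e3.
have aD u v : a (u + v) = a u + a v by exact: linearD.
have a0 : a 0 = 0 by exact: linear0.
apply: etrans (aD _ _) _; rewrite a0 [X in X + _]aD.
apply: etrans (congr2 +%R (congr2 +%R e1 e2) e3) _.
exact: (jacobi_bracket_jacobi LE (existT _ x a) (smooth_linfun smu)
  (smooth_linfun seta) (smooth_linfun sth)).
Qed.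

Let anchor_of_linear x (c : chart M) : cdom c x ->
  linear (fun v : fiber A x => anchor_of v c).
Proof.
move=> cx k u v; apply/rowP => l; rewrite !mxE mulr_sumr -big_split/=.
by apply: eq_bigr => i _; rewrite linearP !mxE mulrDl mulrA.
Qed.

Let anchor_of_smooth (c : chart M) (j : triv A) i l :
  smooth_fun_on M (cdom c `&` vdom j) (fun x => anchor_of (frame j x i) c 0 l).
Proof.
apply: smooth_fun_on_near => x [cx jx].
have [s [ss sx]] := extend_frame i jx; have [f sf fx] := extend_coord l cx.
exists (rho s f); first exact: smooth_rho.
have near_c : \forall z \near x, cdom c z.
  by apply: open_nbhs_nbhs; split => //; exact: cdom_open.
(* [anchor_of_rho] at z requires f to be the coordinate on a neighbourhood of z, hence the
   interior. *)
have near_fx := nbhs_interior fx; near=> z.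
have <- : s z = frame j z i by near: z.
by symmetry; apply: anchor_of_rho; near: z.
Unshelve. all: by end_near. Qed.

(** The l-th component is tested on a global extension f of the l-th coordinate. The components
    agree with the functions [rho mu f] and [rho eta f] near x, so their derivatives agree at x and
    [rho_bracket] applies. *)
Let anchor_of_bracket mu eta : smooth_section mu -> smooth_section eta ->
  eq_field1 (fun x (c : chart M) => anchor_of (section_bracket mu eta x) c)
    (lie_bracket (fun x (c : chart M) => anchor_of (mu x) c)
                 (fun x c => anchor_of (eta x) c)).
Proof.
move=> smu seta x c cx; apply/rowP => l; have [f sf fx] := extend_coord l cx.
have near_c : \forall z \near x, cdom c z.
  by apply: open_nbhs_nbhs; split => //; exact: cdom_open.
have near_fx := nbhs_interior fx.
have rhoE nu i : dpartial c i (fun y => anchor_of (nu y) c 0 l) x = dpartial c i (rho nu f) x.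
  apply: near_eq_dpartial.
  apply: (near_pt (P := fun y => anchor_of (nu y) c 0 l = rho nu f y)) => //.
  by near=> z; apply: anchor_of_rho; near: z.
rewrite (anchor_of_rho _ cx fx) rho_bracket// [RHS]mxE sumrB.
have smr := smooth_rho smu sf; have ser := smooth_rho seta sf.
rewrite -!(vf_apply_anchor _ (rho _ f)).
rewrite (vf_applyE (fun y => anchor_of (mu y)) ser cx).
rewrite (vf_applyE (fun y => anchor_of (eta y)) smr cx).
by congr (_ - _); apply: eq_bigr => i _; rewrite rhoE.
Unshelve. all: by end_near. Qed.

Let section_bracket_leibniz mu eta f :
  smooth_section mu -> smooth_section eta -> smooth_fun M f ->
  forall x, section_bracket mu (fun y => f y *: eta y) x
    = f x *: section_bracket mu eta x
      + vf_apply (fun y (c : chart M) => anchor_of (mu y) c) f x *: eta x.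
Proof.
move=> smu seta sf x; apply: dual_separates => a; rewrite linearD !linearZ.
rewrite !bracket_form//; last exact: smooth_sectionZ.
rewrite bracket_leibniz// bf_apply_linfun_basic// vf_apply_anchor /=.
by congr (_ + _); rewrite mulrC.
Qed.

Definition induced_algebroid : lie_algebroid A :=
  LieAlgebroid smooth_bracket section_bracket_linear section_bracket_anti section_bracket_jacobi anchor_of_linear
    anchor_of_smooth anchor_of_bracket section_bracket_leibniz.

Lemma cocycle_induced : cocycle induced_algebroid cocycle_form.
Proof.
split=> [j i|mu eta smu seta x]; last first.
  by rewrite /anchor_apply !vf_apply_anchor; exact: cocycle_form_bracket.
apply: smooth_fun_on_near => x jx; have [s [ss sx]] := extend_frame i jx.
exists (fun z => cocycle_form z (s z)); first exact: smooth_cocycle_form.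
by apply: filterS sx => z ->.
Qed.

End JacobiToLie.

(** * Components in bundle charts *)

Section Components.
Context {R : realType} {m n : nat} {M : manifold R m} {A : vector_bundle M n}.
Local Notation At := (dual_atlas A).
Implicit Types (c : chart At) (p : dual_total A) (D : lie_algebroid A).

Lemma wedgeE d (u v : 'rV[R]_d) a b :
  wedge u v a b = u 0 a * v 0 b - v 0 a * u 0 b.
Proof. by rewrite !mxE !big_ord1 !mxE. Qed.

Lemma d_mu_mu (i k : 'I_n) : d_mu i 0 (rshift m k) = (k == i)%:R :> R.
Proof. by rewrite mxE (inj_eq (@rshift_inj _ _)). Qed.

Lemma d_mu_x (i : 'I_n) (l : 'I_m) : d_mu i 0 (lshift n l) = 0 :> R.
Proof. by rewrite mxE eq_lrshift andbF. Qed.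

Lemma d_x_x (l k : 'I_m) : d_x l 0 (lshift n k) = (k == l)%:R :> R.
Proof. by rewrite mxE (inj_eq (@lshift_inj _ _)). Qed.

Lemma d_x_mu (l : 'I_m) (k : 'I_n) : d_x l 0 (rshift m k) = 0 :> R.
Proof. by rewrite mxE eq_rlshift andbF. Qed.

Lemma sum_d_mu_mu (w : 'I_n -> R) (k : 'I_n) :
  (\sum_i w i *: d_mu i : 'rV[R]_(m + n)) 0 (rshift m k) = w k.
Proof.
rewrite summxE (bigD1 k)//= mxE d_mu_mu eqxx mulr1 big1 ?addr0// => i ik.
by rewrite mxE d_mu_mu eq_sym (negbTE ik) mulr0.
Qed.

Lemma sum_d_mu_x (w : 'I_n -> R) (l : 'I_m) :
  (\sum_i w i *: d_mu i : 'rV[R]_(m + n)) 0 (lshift n l) = 0.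
Proof. by rewrite summxE big1// => i _; rewrite mxE d_mu_x mulr0. Qed.

(** The sum runs only over i < i', so antisymmetry of S supplies the case b < a, as well as S a a =
    0 on the diagonal. *)
Lemma sum_pick2 (S : 'I_n -> 'I_n -> R) (a b : 'I_n) : (forall i i', S i i' = - S i' i) ->
  \sum_(i < n) \sum_(i' < n | (i < i')%N)
    S i i' * ((a == i)%:R * (b == i')%:R - (a == i')%:R * (b == i)%:R) = S a b.
Proof.
move=> anti.
have one (u v : 'I_n) : \sum_(i < n) \sum_(i' < n | (i < i')%N)
    S i i' * ((u == i)%:R * (v == i')%:R) = if (u < v)%N then S u v else 0.
  rewrite (bigD1 u)//= [X in _ + X]big1 ?addr0; last first.
    move=> i iu; rewrite big1// => i' _.
    by rewrite eq_sym (negbTE iu) mul0r mulr0.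
  rewrite big_mkcond (bigD1 v)//= big1 ?addr0 ?eqxx ?mulr1// => i' i'v.
  by case: ifP => // _; rewrite [v == i']eq_sym (negbTE i'v) !mulr0.
transitivity ((if (a < b)%N then S a b else 0) - (if (b < a)%N then S b a else 0)).
  rewrite -!one -sumrB; apply: eq_bigr => i _; rewrite -sumrB.
  by apply: eq_bigr => i' _; rewrite mulrBr; congr (_ - _ * _); rewrite mulrC.
case: ltngtP => [_|_|/val_inj ->]; rewrite ?subr0 ?sub0r//.
by have := anti b b; lra.
Qed.

Lemma poisson_mu_mu D p c a b
    (S := fun i i' => \sum_k struct_fun D c.2 (dual_proj p) i i' k * mu_coord c p k) :
  (forall i i', S i i' = - S i' i) ->
  poisson_dual D p c (rshift m a) (rshift m b) = S a b.
Proof.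
move=> anti; rewrite -(sum_pick2 a b anti) /poisson_dual mxE.
rewrite [X in _ + X]summxE [X in _ + X]big1 ?addr0 => [|i _]; last first.
  by rewrite summxE big1// => l _; rewrite mxE wedgeE !d_x_mu !mulr0 mul0r subr0 mulr0.
rewrite summxE; apply: eq_bigr => i _; rewrite summxE; apply: eq_bigr => i' _.
by rewrite -scaler_suml mxE wedgeE !d_mu_mu.
Qed.

Lemma poisson_mu_x D p c i l :
  poisson_dual D p c (rshift m i) (lshift n l) = anchor_fun D c (dual_proj p) i l.
Proof.
rewrite /poisson_dual mxE summxE big1 ?add0r => [|k _]; last first.
  rewrite summxE big1// => k' _; rewrite summxE big1// => k'' _.
  by rewrite mxE wedgeE !d_mu_x !mulr0 subr0 mulr0.
rewrite summxE (bigD1 i)//= [X in _ + X]big1 ?addr0 => [|k ki]; last first.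
  rewrite summxE big1// => l' _; rewrite mxE wedgeE d_mu_mu d_x_mu.
  by rewrite eq_sym (negbTE ki) !mul0r subr0 mulr0.
rewrite summxE (bigD1 l)//= [X in _ + X]big1 ?addr0 => [|l' l'l]; last first.
  by rewrite mxE wedgeE d_x_mu d_x_x eq_sym (negbTE l'l) mul0r mulr0 subr0 mulr0.
by rewrite mxE wedgeE d_mu_mu d_x_x d_x_mu !eqxx mul0r subr0 !mulr1.
Qed.

Lemma poisson_x_x D p c l l' : poisson_dual D p c (lshift n l) (lshift n l') = 0.
Proof.
rewrite /poisson_dual mxE !summxE !big1 ?addr0// => i _; rewrite summxE big1// => k _.
  by rewrite mxE wedgeE !d_mu_x mul0r mulr0 subr0 mulr0.
by rewrite summxE big1// => k' _; rewrite mxE wedgeE !d_mu_x mul0r subr0 mulr0.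
Qed.

Lemma wedge_anti d (u v : 'rV[R]_d) a b : wedge u v a b = - wedge u v b a.
Proof. by rewrite !wedgeE; ring. Qed.

Lemma poisson_anti D p c a b : poisson_dual D p c a b = - poisson_dual D p c b a.
Proof.
rewrite /poisson_dual !mxE !summxE opprD -!sumrN; congr (_ + _); apply: eq_bigr => i _.
  rewrite !summxE -sumrN; apply: eq_bigr => k _; rewrite !summxE -sumrN.
  by apply: eq_bigr => k' _; rewrite mxE [in RHS]mxE wedge_anti mulrN.
rewrite !summxE -sumrN; apply: eq_bigr => k _.
by rewrite mxE [in RHS]mxE wedge_anti mulrN.
Qed.

Lemma partial_coordinate d (a b : 'I_d) (y : 'rV[R]_d) :
  partial a (fun y => y 0 b) y = (a == b)%:R.
Proof.
have e : (fun t : R => (t *: delta_mx 0 a + y) 0 b) = (fun t => t * (a == b)%:R + y 0 b).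
  by apply/funext => t; rewrite !mxE eqxx eq_sym.
rewrite /partial derive_line e.
have D := is_deriveD (is_derive_fmul (is_derive_id (0 : R) (1 : R))
  (is_derive_cst ((a == b)%:R : R) (0 : R) (1 : R))) (is_derive_cst (y 0 b) (0 : R) (1 : R)).
by rewrite (@derive_val _ _ _ _ _ _ _ D) mulr0 mul1r !addr0.
Qed.

Lemma near_dual_pt c p (P : M -> Prop) : cdom c p -> (\forall x \near dual_proj p, P x) ->
  \forall y \near co c p, P (pt c.1 (lsubmx y)).
Proof.
move=> [cx _] Px; have := near_pt cx Px.
have <- : lsubmx (co c p) = co c.1 (dual_proj p) by exact: row_mxKl.
move=> Pu; exact: ((@continuous_lsubmx _ _ _ _ (co c p)) _ Pu).
Qed.

Lemma dpartial_frame_linfun c p i s a : cdom c p ->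
  (\forall x \near dual_proj p, s x = frame c.2 x i) ->
  dpartial c a (linfun s) p = (a == rshift m i)%:R.
Proof.
move=> cp sx; rewrite -(partial_coordinate a (rshift m i) (co c p)).
have near_j : \forall x \near dual_proj p, vdom c.2 x.
  by apply: open_nbhs_nbhs; split; [exact: vdom_open|case: cp].
apply: near_eq_derive.
have near_s := near_dual_pt cp sx; have near_j' := near_dual_pt cp near_j.
near=> y; have sy : s (pt c.1 (lsubmx y)) = frame c.2 (pt c.1 (lsubmx y)) i by near: y.
have jy : vdom c.2 (pt c.1 (lsubmx y)) by near: y.
rewrite /= /linfun /dual_pt /= /dual_form /= sy.
by rewrite coform_frame// mxE.
Unshelve. all: by end_near. Qed.

Lemma dpartial_coord_basic c p l f a : cdom c p ->
  (\forall x \near dual_proj p, f x = co c.1 x 0 l) ->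
  dpartial c a (f \o @dual_proj _ _ _ _ A) p = (a == lshift n l)%:R.
Proof.
move=> cp fx; rewrite -(partial_coordinate a (lshift n l) (co c p)).
apply: near_eq_derive; have near_f := near_dual_pt cp fx.
have near_U := near_co_image cp; near=> y.
have fy : f (pt c.1 (lsubmx y)) = co c.1 (pt c.1 (lsubmx y)) 0 l by near: y.
have [q [cq _] qy] : (co c @` cdom c) y by near: y.
by rewrite /= fy -qy /= row_mxKl row_mxEl coK.
Unshelve. all: by end_near. Qed.

Lemma frame_extP (j : triv A) x i : vdom j x ->
  smooth_section (frame_ext j x i) /\ \forall y \near x, frame_ext j x i y = frame j y i.
Proof.
move=> jx; rewrite /frame_ext; case: pselect => [h|[]]; last exact: extend_frame.
exact: (svalP (cid h)).
Qed.

End Components.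

Lemma vf_apply_coordinate (R : realType) (d : nat) (N : Type) (At : atlas R d N)
    (X : vector_field At) (F : N -> R) (c : chart At) (p : N) (b : 'I_d) :
  smooth_fun At F -> cdom c p -> (forall a, dpartial c a F p = (a == b)%:R) ->
  vf_apply (comp1 X) F p = X p c 0 b.
Proof.
move=> sF cp dF; rewrite (@vf_applyE _ _ _ _ X F c p)// (bigD1 b)//= dF eqxx mulr1.
by rewrite big1 ?addr0// => a ab; rewrite dF (negbTE ab) mulr0.
Qed.

Lemma bf_apply_coordinate (R : realType) (d : nat) (N : Type) (At : atlas R d N)
    (P : bivector_field At) (F G : N -> R) (c : chart At) (p : N) (b b' : 'I_d) :
  smooth_fun At F -> smooth_fun At G -> cdom c p ->
  (forall a, dpartial c a F p = (a == b)%:R) ->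
  (forall a, dpartial c a G p = (a == b')%:R) ->
  bf_apply (comp2 P) F G p = P p c b b'.
Proof.
move=> sF sG cp dF dG; rewrite (@bf_applyE _ _ _ _ P F G c p)// (bigD1 b)//=.
rewrite [X in _ + X]big1 ?addr0 => [|a ab]; last first.
  by rewrite big1// => a' _; rewrite dF (negbTE ab) mulr0 mul0r.
rewrite (bigD1 b')//= dF dG !eqxx !mulr1 big1 ?addr0// => a ab.
by rewrite dG (negbTE ab) mulr0.
Qed.

Theorem theorem2 (R : realType) (m n : nat) (n_gt0 : (0 < n)%N)
    (M : manifold R m) (A : vector_bundle M n)
    (L : bivector_field (dual_atlas A)) (E : vector_field (dual_atlas A))
    (LE_jacobi : jacobi_structure L E)
    (C1 : forall F G, linear_function F -> linear_function G ->
       linear_function (jacobi_bracket L E F G))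
    (C2 : forall F, linear_function F ->
       basic_function (jacobi_bracket L E F (fun=> 1))) :
  exists (D : lie_algebroid A) (phi : forall x, {scalar fiber A x}),
    cocycle D phi /\
    eq_field2 (comp2 L) (jacobi_dual2 D phi) /\
    eq_field1 (comp1 E) (jacobi_dual1 phi).
Proof.
pose phi := cocycle_form E.
(* Only the bracket, the anchor and the cocycle property of the algebroid are kept visible. *)
have [D [cD abrE anchorE]] : exists D : lie_algebroid A,
    [/\ cocycle D phi, abr D = section_bracket L E & anchor D = anchor_of L].
  by exists (induced_algebroid n_gt0 LE_jacobi C1 C2); split=> //; exact: cocycle_induced.
exists D, phi; split=> //.
split=> p c cp; have [cx jx] := cp; set x := dual_proj p in cx jx.
- pose s := frame_ext c.2 x.
  have ss i : smooth_section (s i) by have [] := frame_extP i jx.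
  have sx i : \forall y \near x, s i y = frame c.2 y i by have [] := frame_extP i jx.
  have sl i := smooth_linfun (ss i).
  have ds i a := dpartial_frame_linfun a cp (sx i).
  have sxx i : s i x = frame c.2 x i by exact: nbhs_singleton (sx i).
  (* The defining formula of {s_i~, s_k~} is solved for its bivector term. As E(s~) = - phi(s), the
     two correction terms are exactly the components of Delta /\ phi^v. *)
  have L_mu_mu i k : L p c (rshift m i) (rshift m k) =
      dual_form p (abr D (s i) (s k) x) + mu_coord c p i * phi x (frame c.2 x k)
      - mu_coord c p k * phi x (frame c.2 x i).
    rewrite -(bf_apply_coordinate L (sl i) (sl k) cp (ds i) (ds k)).
    have := section_bracketP C1 (ss i) (ss k).
    move=> [_ /(congr1 (fun F => F p))]; rewrite {1}/jacobi_bracket -abrE.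
    rewrite !(vf_apply_linfun C2)// /linfun -/x !sxx => <-.
    by rewrite /mu_coord; ring.
  have L_mu_x i l : L p c (rshift m i) (lshift n l) = anchor_fun D c x i l.
    have [f sf fx] := extend_coord l cx.
    have dcf a := dpartial_coord_basic a cp fx.
    rewrite -(bf_apply_coordinate L (sl i) (smooth_basic sf) cp (ds i) dcf).
    rewrite (bf_apply_linfun_basic n_gt0 C1 C2)// -(anchor_of_rho L _ cx fx).
    by rewrite /anchor_fun anchorE sxx.
  have L_x_x l l' : L p c (lshift n l) (lshift n l') = 0.
    have [f sf fx] := extend_coord l cx; have [f' sf' fx'] := extend_coord l' cx.
    have dcf a := dpartial_coord_basic a cp fx.
    have dcf' a := dpartial_coord_basic a cp fx'.
    rewrite -(bf_apply_coordinate L (smooth_basic sf) (smooth_basic sf') cp dcf dcf').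
    exact: (bf_apply_basic n_gt0 C1 C2).
  (* The sections s are the very extensions that enter [struct_fun], so its values are the
     coordinates of this bracket in the frame at x. *)
  have struct i k : \sum_l struct_fun D c.2 x i k l * mu_coord c p l =
      dual_form p (abr D (s i) (s k) x).
    rewrite -[in RHS](coordK (abr D (s i) (s k) x) jx) linear_sum.
    by apply: eq_bigr => l _; rewrite linearZ.
  (* Required because [poisson_dual] sums over i < i' only. *)
  have anti i k : \sum_l struct_fun D c.2 x i k l * mu_coord c p l =
      - \sum_l struct_fun D c.2 x k i l * mu_coord c p l.
    have e : abr D (s i) (s k) x = - abr D (s k) (s i) x by exact: abr_anti.
    by apply: etrans (struct i k) _; rewrite (struct k i) e; exact: linearN.
  rewrite /comp2 /jacobi_dual2 /liouville /vlift; apply/matrixP => a b.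
  rewrite [RHS]mxE wedgeE.
  case: (split_ordP a) => a' ->; case: (split_ordP b) => b' ->.
  + by rewrite poisson_x_x !sum_d_mu_x L_x_x; ring.
  + by rewrite poisson_anti poisson_mu_x !sum_d_mu_x (bcomp_anti _ _ _ cp) L_mu_x; ring.
  + by rewrite poisson_mu_x !sum_d_mu_x L_mu_x; ring.
  + rewrite poisson_mu_mu// !sum_d_mu_mu struct L_mu_mu -/x.
    by rewrite [phi x (frame c.2 x a') * _]mulrC addrA.
- rewrite /comp1 /jacobi_dual1 /vlift; apply/rowP => b; rewrite mxE.
  case: (split_ordP b) => k ->.
    rewrite sum_d_mu_x oppr0; have [f sf fx] := extend_coord k cx.
    have dcf a := dpartial_coord_basic a cp fx.
    rewrite -(vf_apply_coordinate E (smooth_basic sf) cp dcf).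
    exact: (vf_apply_basic n_gt0 C2).
  rewrite sum_d_mu_mu; have [ss sx] := frame_extP k jx.
  have ds a := dpartial_frame_linfun a cp sx.
  rewrite -(vf_apply_coordinate E (smooth_linfun ss) cp ds) (vf_apply_linfun C2)//.
  by rewrite -/x (nbhs_singleton sx).
Qed.
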